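(* Let $\mathbb{K}$ be a number field, let $U:\mathbb{Z}\to\mathbb{K}$ be a non-degenerate linear recurrence sequence of (minimal) order $2$, and let $a\in\mathbb{Z}$ be a twisted zero of $U$. Then there are infinitely many primes $\mathfrak{p}$ of $\mathbb{K}$ with the following property, where $p$ denotes the rational prime below $\mathfrak{p}$: there exist $Q\in\mathbb{Z}_{>0}$, $a'\in\{0,1,\dots,Q-1\}$ and $\tau\in\mathbb{Z}$ with $p\nmid Q$ such that $\nu_{\mathfrak{p}}(U(n))=\nu_p(n-a)+\tau$ for every $n\in\mathbb{Z}$ with $n\equiv a'\pmod Q$. (In particular $\nu_p(n-a)$ is unbounded on this residue class.)
   Context: A $\mathbb{K}$-valued linear recurrence sequence is a map $U:\mathbb{Z}\to\mathbb{K}$ with $U(n+m)=a_{m-1}U(n+m-1)+\dots+a_0U(n)$ for all $n$, $a_i\in\mathbb{K}$, $a_0\ne0$, $m$ minimal. With $\lambda_1,\dots,\lambda_s$ the distinct roots of $X^m-a_{m-1}X^{m-1}-\dots-a_0$, $U(n)=\sum_i f_i(n)\lambda_i^n$ with nonzero polynomials $f_i$. $U$ is non-degenerate if $U\ne0$ and $\lambda_k/\lambda_\ell$ is not a root of unity for $k\ne\ell$. An integer $a$ is a twisted zero of $U$ if $\sum_i\xi_if_i(a)\lambda_i^a=0$ for some roots of unity $\xi_1,\dots,\xi_s$. $\nu_{\mathfrak{p}}$ is the normalized $\mathfrak{p}$-adic valuation, $\nu_p$ the $p$-adic valuation. *)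

(* Defs.v *)
From HB Require Import structures.
From mathcomp Require Import all_boot all_order all_algebra all_field.
From mathcomp Require Import ring_quotient.
From mathcomp Require Import boolp classical_sets cardinality.
From mathcomp Require Import constructive_ereal.

Set Implicit Arguments.
Unset Strict Implicit.
Unset Printing Implicit Defensive.

Import Order.TTheory GRing.Theory Num.Theory.

Local Open Scope classical_set_scope.
Local Open Scope ring_scope.

(** * Ideals of a commutative ring *)

Section Ideals.
Variable R : comNzRingType.

(* The zero ideal is excluded: the primes of a number field are the maximal
   ideals of its ring of integers. *)
Definition nonzero_prime_ideal (P : set R) : Prop :=
  [/\ idealr_closed (mem P), prime_idealr_closed (mem P)
    & exists2 x, x \in P & x != 0].

Definition ideal_mul (I J : set R) : set R :=
  [set x | exists (n : nat) (u v : 'I_n -> R),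
     (forall i, I (u i) /\ J (v i)) /\ x = \sum_(i < n) u i * v i].

Definition ideal_exp (I : set R) (k : nat) : set R :=
  iter k (ideal_mul I) setT.

End Ideals.

(** * The ring of integers of a number field and its valuations *)

Section NumberField.
Variable K : fieldExtType rat.

Definition integers_pred : {pred K} :=
  fun x => `[< integralOver (intr : int -> K) x >].

Lemma integers_subring : subring_closed integers_pred.
Proof.
split; first by apply/asboolP; exact: integral1.
- by move=> x y /asboolP ix /asboolP iy; apply/asboolP; exact: integral_sub.
- by move=> x y /asboolP ix /asboolP iy; apply/asboolP; exact: integral_mul.
Qed.

HB.instance Definition _ :=
  GRing.isSubringClosed.Build K integers_pred integers_subring.

Record integers := Integers {
  integers_val :> K;
  integers_valP : integers_val \in integers_pred }.

HB.instance Definition _ := [isSub for integers_val].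
HB.instance Definition _ := [Choice of integers by <:].
HB.instance Definition _ := [SubChoice_isSubComNzRing of integers by <:].

Definition ideal_ord (P : set integers) (y : integers) (i : nat) : Prop :=
  ideal_exp P i y /\ ~ ideal_exp P i.+1 y.

(* Normalized so that its value group is Z.  When P is a nonzero prime ideal
   the integer k below exists and is unique for every x != 0, so the default
   value of xget plays no role. *)
Definition valuation (P : set integers) (x : K) : \bar int :=
  if x == 0 then +oo%E else
  (xget 0 [set k : int | exists (y z : integers) (i j : nat),
     [/\ z != 0, x = (y : K) / (z : K), ideal_ord P y i, ideal_ord P z j
       & k = i%:Z - j%:Z]])%:E.

End NumberField.

Definition padic_valuation (p : nat) (m : int) : \bar int :=
  if m == 0 then +oo%E else ((logn p `|m|%N)%:Z)%:E.

(** * Linear recurrence sequences *)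

Definition root_of_unity (z : algC) : Prop :=
  exists2 k : nat, (0 < k)%N & k.-unity_root z.

Section Recurrence.
Variable K : fieldExtType rat.
Implicit Types U : int -> K.

(* For m = 0 this says that U is identically zero. *)
Definition recurrence (m : nat) (a : 'I_m -> K) U : Prop :=
  (forall i : 'I_m, i = 0%N :> nat -> a i != 0) /\
  (forall n : int, U (n + m%:Z) = \sum_(i < m) a i * U (n + i%:Z)).

Definition minimal_recurrence (m : nat) (a : 'I_m -> K) U : Prop :=
  recurrence a U /\
  (forall (m' : nat) (a' : 'I_m' -> K), recurrence a' U -> (m <= m')%N).

Definition lrs_of_order (m : nat) U : Prop :=
  exists a : 'I_m -> K, minimal_recurrence a U.

Definition char_poly_rec (m : nat) (a : 'I_m -> K) : {poly K} :=
  'X^m - \sum_(i < m) a i *: 'X^i.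

(* iota makes algC the algebraic closure of K in which the roots of the
   characteristic polynomial and the roots of unity are taken. *)
Variable iota : {rmorphism K -> algC}.

Definition char_root U (z : algC) : Prop :=
  exists (m : nat) (a : 'I_m -> K),
    minimal_recurrence a U /\ root (map_poly iota (char_poly_rec a)) z.

Definition non_degenerate U : Prop :=
  (exists n, U n != 0) /\
  (forall z w, char_root U z -> char_root U w -> z != w ->
     ~ root_of_unity (z / w)).

Definition exponential_form U (s : nat)
    (f : 'I_s -> {poly algC}) (lambda : 'I_s -> algC) : Prop :=
  [/\ injective lambda,
      (forall z, char_root U z <-> exists i, z = lambda i),
      (forall i, f i != 0)
    & (forall n : int,
         iota (U n) = \sum_(i < s) (f i).[n%:~R] * lambda i ^ n)].

Definition twisted_zero U (a : int) : Prop :=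
  exists (s : nat) (f : 'I_s -> {poly algC}) (lambda xi : 'I_s -> algC),
    [/\ exponential_form U f lambda,
        (forall i, root_of_unity (xi i))
      & \sum_(i < s) xi i * (f i).[a%:~R] * lambda i ^ a = 0].

End Recurrence.

(* Main.v *)
Require Import Defs.
From mathcomp Require Import all_boot all_order all_algebra all_field.
From mathcomp Require Import boolp classical_sets cardinality.
From mathcomp Require Import constructive_ereal.
From mathcomp Require Import ring zify.

Import Order.TTheory GRing.Theory Num.Theory.

Local Open Scope classical_set_scope.
Local Open Scope ring_scope.

(* Either U(n) = c (n - a) x^n, and every large unramified prime works, or
   U(n) = c x^n (1 - xi mu^(n-a)) with xi^r = 1 and mu not a root of unity.  In
   the second case let P be a large prime modulo which some power of mu has order
   exactly 6r, and let Q = |F| - 1 for a finite field F containing the residue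
   field of P.  Then xi is congruent to a power of mu, so xi mu^(n-a) = 1 mod P on
   a residue class modulo Q, and lifting the exponent, with rQ prime to p, gives
     v_P(xi mu^(n-a) - 1) = v_P(mu^(rQ (n-a)) - 1) = v_P(mu^(rQ) - 1) + v_p(n - a).

   There are infinitely many such P.  Let g be the primitive integral minimal
   polynomial of mu and R_k the resultant of g and Phi_6r(X^k), realized as the
   determinant of g at a companion matrix.  A large prime dividing R_k yields a P
   as wanted.  For k divisible by the orders of the roots of g modulo the primes
   up to B, none of these divides R_k, since 1 is never a root of Phi_6r modulo
   p.  So if no larger prime divides R_k either, then R_k = 1 or -1 for all k in
   an arithmetic progression.  But R_k is Phi_6r(mu^k) times an exponential sum
   in k, and such a product cannot be constantly 1 up to sign, because formally
   mu^k may be replaced by a root of Phi_6r. *)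

(** * Integer polynomials modulo a prime *)

Local Notation Zto F G := (map_poly (intr : int -> F) G).

Lemma map_poly_lift_Fp (p : nat) (P : {poly 'F_p}) :
  exists G : {poly int}, Zto 'F_p G = P.
Proof.
exists (\poly_(i < size P) (nat_of_ord (P`_i)%R)%:Z); apply/polyP=> i.
rewrite coef_map coef_poly /=; case: ltnP => [_|/(nth_default 0)->]; last by [].
by rewrite -pmulrn natr_Zp.
Qed.

Lemma map_poly_eq0_pchar (F : nzRingType) (p : nat) (G : {poly int}) :
  p \in [pchar F] -> Zto F G = 0 -> exists H : {poly int}, G = p%:Z *: H.
Proof.
move=> pF G0; exists (\poly_(i < size G) ((G`_i)%R %/ p%:Z)%Z); apply/polyP=> i.
rewrite coefZ coef_poly; case: ltnP => [_|/(nth_default 0)->]; last by rewrite mulr0.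
rewrite mulrC divzK // (dvdz_pcharf pF).
by have := congr1 (fun P : {poly F} => P`_i) G0; rewrite coef_map coef0 => ->.
Qed.

Lemma exists_splitting_finField (p : nat) (g : {poly int}) :
  prime p -> Zto 'F_p g != 0 ->
  exists F : finFieldType, p \in [pchar F] /\
    exists rs : seq F, Zto F g %= \prod_(x <- rs) ('X - x%:P).
Proof.
move=> p_pr g0; have [L [rs grs _]] := FinSplittingFieldFor g0.
exists (finvect_type L); split.
  by have := pchar_Fp p_pr; rewrite -(pchar_lalg L).
exists rs; suff -> : Zto (finvect_type L) g = map_poly (in_alg L) (Zto 'F_p g) by [].
by rewrite -map_poly_comp; apply: eq_map_poly => x; apply/esym/(rmorph_int (in_alg L)).
Qed.

(** Coprimality is tested over the prime field, whose Bezout coefficients lift to the integers. If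
    it fails, the common factor has a root in [F] because [g] splits there. *)
Lemma common_root_or_Bezout (F : finFieldType) (p : nat) (g h : {poly int})
    (rs : seq F) :
  p \in [pchar F] -> Zto F g %= \prod_(x <- rs) ('X - x%:P) ->
  (exists2 x, root (Zto F g) x & root (Zto F h) x) \/
  exists u v w : {poly int}, u * g + v * h = 1 + p%:Z *: w.
Proof.
move=> pF grs; have p_pr := pcharf_prime pF.
have Fg G : Zto F G = map_poly (in_alg (pPrimeCharType pF)) (Zto 'F_p G).
  rewrite -map_poly_comp; apply: eq_map_poly => x.
  exact/esym/(rmorph_int (in_alg (pPrimeCharType pF))).
have [co|nco] := boolP (coprimep (Zto 'F_p g) (Zto 'F_p h)); [right|left].
  have [[u v] /= uv1] := Bezout_eq1_coprimepP _ _ co.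
  have [[u1 u1E] [v1 v1E]] := (map_poly_lift_Fp p u, map_poly_lift_Fp p v).
  have : Zto 'F_p (u1 * g + v1 * h - 1) = 0.
    by rewrite rmorphB rmorphD !rmorphM rmorph1 /= u1E v1E uv1 subrr.
  case/(map_poly_eq0_pchar _ _ _ (pchar_Fp p_pr)) => w wE; exists u1, v1, w.
  by rewrite -wE [RHS]addrC subrK.
have [x xrs hx] : exists2 x, x \in rs & root (Zto F h) x.
  apply/hasP; apply: contraNT nco => /hasPn nh.
  rewrite -(coprimep_map (in_alg (pPrimeCharType pF))) -!Fg.
  rewrite (eqp_coprimepl _ grs) coprimep_sym.
  elim: rs nh {grs} => [|y rs IH] nh; first by rewrite big_nil coprimep1.
  rewrite big_cons coprimepMr IH ?andbT => [|z zrs].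
    by rewrite coprimep_XsubC nh ?mem_head.
  by rewrite nh // inE zrs orbT.
by exists x => //; rewrite (eqp_root grs) root_prod_XsubC.
Qed.

(** Elements of [F] are fixed by the power [#|F|], so the remainder of [G ^+ #|F| - G] modulo [f]
    vanishes in [F] at every point of [rs]. These are more roots than its degree allows unless it
    reduces to zero. *)
Lemma Frobenius_mod (F : finFieldType) (p : nat) (f : {poly int}) (rs : seq F) :
  p \in [pchar F] -> f \is monic -> uniq rs ->
  Zto F f %= \prod_(x <- rs) ('X - x%:P) ->
  forall G : {poly int}, exists A B : {poly int},
    G ^+ #|F| - G = f * A + p%:Z *: B.
Proof.
move=> pF f_mon urs frs G; set H := _ - G.
have := Pdiv.RingMonic.rdivp_eq f_mon H.
set A := Pdiv.CommonRing.rdivp _ _; set R := Pdiv.CommonRing.rmodp _ _ => HE.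
have sR : (size R < size f)%N by rewrite Pdiv.CommonRing.ltn_rmodp monic_neq0.
suff /(map_poly_eq0_pchar _ _ _ pF) [B BE] : Zto F R = 0.
  by exists A, B; rewrite HE BE mulrC.
apply: contraTeq (sR) => R0; rewrite -leqNgt.
have sf : size f = (size rs).+1.
  rewrite -(size_prod_XsubC rs id) -(eqp_size frs) size_map_poly_id0 //.
  by rewrite (monicP f_mon) rmorph1 oner_eq0.
rewrite sf; apply: leq_trans (size_poly _ _ : (size (Zto F R) <= _)%N).
apply: max_poly_roots => //; apply/allP => x xrs.
have fx : root (Zto F f) x by rewrite (eqp_root frs) root_prod_XsubC.
have -> : R = H - A * f by rewrite HE addrC addKr.
rewrite /root rmorphB rmorphM /= hornerD hornerN hornerM (eqP fx) mulr0 subr0.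
by rewrite rmorphB rmorphXn /= hornerD hornerN horner_exp expf_card subrr.
Qed.

(** * Exponential sums *)

Section ExponentialSums.
Variable F : fieldType.

Lemma interpolation (s : seq F) (psi : F -> F) :
  exists h : {poly F}, forall x, x \in s -> h.[x] = psi x.
Proof.
elim: s => [|x s [h hE]]; first by exists 0.
have [xs|xs] := boolP (x \in s).
  by exists h => y; rewrite inE => /orP[/eqP->|]; apply: hE.
pose m := \prod_(y <- s) ('X - y%:P).
have mx : m.[x] != 0 by rewrite -/(root m x) root_prod_XsubC.
exists (h + ((psi x - h.[x]) / m.[x]) *: m) => y; rewrite hornerD hornerZ inE.
have [->|yx /= ys] := eqVneq y x; first by rewrite divfK // addrC subrK.
have /eqP-> : root m y by rewrite root_prod_XsubC.
by rewrite mulr0 addr0 hE.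
Qed.

Definition expsum (W : nat -> F) : Prop :=
  exists s : seq (F * F), forall j, W j = \sum_(u <- s) u.1 * u.2 ^+ j.

Lemma expsum_geom (c x : F) : expsum (fun j => c * x ^+ j).
Proof. by exists [:: (c, x)] => j; rewrite big_seq1. Qed.

Lemma expsum_horner (P : {poly F}) (x : F) : expsum (fun j => P.[x ^+ j]).
Proof.
exists [seq (P`_i, x ^+ i) | i <- iota 0 (size P)] => j.
rewrite horner_coef big_map /= -[size P]subn0 -/(index_iota _ _) big_mkord subn0.
by apply: eq_bigr => i _; rewrite exprAC.
Qed.

Lemma expsumM (V W : nat -> F) :
  expsum V -> expsum W -> expsum (fun j => V j * W j).
Proof.
move=> [s sE] [t tE].
exists [seq (u.1 * v.1, u.2 * v.2) | u <- s, v <- t] => j.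
rewrite sE tE big_allpairs_dep mulr_suml; apply: eq_bigr => u _.
by rewrite mulr_sumr; apply: eq_bigr => v _ /=; rewrite exprMn mulrACA.
Qed.

Lemma expsum_prod (I : Type) (s : seq I) (W : I -> nat -> F) :
  (forall i, expsum (W i)) -> expsum (fun j => \prod_(i <- s) W i j).
Proof.
move=> expW; elim: s => [|i s IH].
  by exists [:: (1, 1)] => j; rewrite big_nil big_seq1 expr1n mulr1.
have [t tE] := expsumM _ _ (expW i) IH.
by exists t => j; rewrite big_cons tE.
Qed.

(* [psi] is multiplicative along the cyclic group of [nu], hence extends to a
   functional killing every multiple of [P], although an exponential sum taking
   the constant value [1] is sent to [psi 1 = 1]. *)
Lemma expsum_not_inverse (P : {poly F}) (nu z : F) (W : nat -> F) :
  root P z -> z != 0 -> nu != 0 -> (forall n, (0 < n)%N -> nu ^+ n != 1) ->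
  expsum W -> ~ (forall j, P.[nu ^+ j] * W j = 1).
Proof.
move=> Pz z0 nu0 nun1 [s WE] PW1.
have nu_inj e e' : nu ^ e = nu ^ e' -> e = e'.
  move=> ee'; have : nu ^ (e - e') = 1.
    by rewrite expfzDr // -invr_expz ee' divff ?expfz_neq0.
  case E: (e - e') => [[|n]|n] /eqP; last 2 first.
  - by rewrite -exprnP (negPf (nun1 _ _)).
  - by rewrite NegzE -invr_expz -exprnP invr_eq1 (negPf (nun1 _ _)).
  by move/eqP: E; rewrite subr_eq0 => /eqP.
(* Off the cyclic group of [nu], the value 0 keeps psi(x nu^i) = psi(x) z^i valid for every x. *)
pose psi x := if pselect (exists e : int, x = nu ^ e) is left h
  then z ^ (projT1 (cid h)) else 0.
have psiE e : psi (nu ^ e) = z ^ e.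
  rewrite /psi; case: pselect => [h|[]]; last by exists e.
  by case: cid => e' /= /nu_inj ->.
have psiM x i : psi (x * nu ^+ i) = psi x * z ^+ i.
  have [[e ->]|nx] := pselect (exists e : int, x = nu ^ e).
    by rewrite !exprnP -!expfzDr // !psiE expfzDr.
  rewrite /psi; case: pselect => [[e xe]|_].
    case: nx; exists (e - i%:Z); rewrite expfzDr // -xe -invr_expz -exprnP mulfK //.
    by rewrite expf_neq0.
  by case: pselect => // _; rewrite mul0r.
(* For h = X^k the left side is P(nu^k) W(k) = 1; the general case follows by linearity. *)
have key (h : {poly F}) :
    \sum_(i < size P) \sum_(u <- s) P`_i * u.1 * h.[u.2 * nu ^+ i] = h.[1].
  transitivity (\sum_(k < size h) h`_k * (P.[nu ^+ k] * W k)); last first.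
    by rewrite horner_coef; apply: eq_bigr => k _; rewrite PW1 expr1n.
  under eq_bigr => i _ do under eq_bigr => u _ do rewrite horner_coef mulr_sumr.
  under eq_bigr => i _ do rewrite exchange_big /=.
  rewrite exchange_big /=; apply: eq_bigr => k _.
  rewrite horner_coef mulr_suml mulr_sumr; apply: eq_bigr => i _.
  rewrite WE !mulr_sumr; apply: eq_bigr => u _.
  by rewrite exprMn exprAC; ring.
(* Only finitely many points occur in [key], so a polynomial can stand in for [psi].
   Multiplicativity then pulls the factor P(z) = 0 out of the sum. *)
have [h hE] := interpolation
  (1 :: [seq u.2 * nu ^+ i | u <- s, i <- iota 0 (size P)]) psi.
have : h.[1] = 1 by rewrite hE ?mem_head // -[X in psi X](expr0z nu) psiE expr0z.
rewrite -key.
have -> : \sum_(i < size P) \sum_(u <- s) P`_i * u.1 * h.[u.2 * nu ^+ i] =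
    P.[z] * \sum_(u <- s) u.1 * psi u.2.
  rewrite horner_coef mulr_suml; apply: eq_bigr => i _.
  rewrite mulr_sumr big_seq [RHS]big_seq; apply: eq_bigr => u us.
  rewrite hE ?psiM; last first.
    rewrite inE; apply/orP; right; apply/allpairsP; exists (u, val i).
    by split=> //=; rewrite mem_iota ltn_ord.
  by rewrite -!mulrA; congr (_ * _); rewrite [RHS]mulrCA [z ^+ _ * _]mulrC.
by rewrite (eqP Pz) mul0r => /esym/eqP; rewrite oner_eq0.
Qed.

End ExponentialSums.


(** Put m = r / q. Since r does not divide m, Phi_r divides (X^r - 1) / (X^m - 1), the sum of the
    X^(m i) for i < q. Where x^m = 1 this sum takes the value q, which is nonzero in [F]. *)
Lemma root_Cyclotomic_order (F : fieldType) (r q : nat) (x : F) :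
  (0 < r)%N -> (1 < q)%N -> (q %| r)%N -> q%:R != 0 :> F ->
  root (Zto F 'Phi_r) x -> x ^+ r = 1 /\ x ^+ (r %/ q) != 1.
Proof.
move=> r0 q1 qr qF rx.
set m := (r %/ q)%N; have rE : r = (m * q)%N by rewrite divnK.
have q0 : (0 < q)%N := ltnW q1.
have m0 : (0 < m)%N by rewrite divn_gt0 // dvdn_leq.
have mr : (m < r)%N by rewrite rE ltn_Pmulr.
have PhiE : exists T : {poly int}, \sum_(i < q) 'X^(m * i) = 'Phi_r * T.
  exists (\prod_(d <- divisors r | (d != r) && ~~ (d %| m)%N) 'Phi_d).
  have Xm : 'X^m - 1 != 0 :> {poly int}.
    by rewrite -size_poly_eq0 size_XnsubC.
  apply: (mulfI Xm).
  have -> : ('X^m - 1) * \sum_(i < q) 'X^(m * i) = 'X^r - 1 :> {poly int}.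
    rewrite rE exprM -[1 in RHS](expr1n _ q) subrXX; congr (_ * _).
    rewrite (reindex_inj rev_ord_inj) /=; apply: eq_bigr => i _.
    rewrite expr1n mulr1 exprM; congr (_ ^+ _).
    by have := ltn_ord i; lia.
  rewrite -(prod_Cyclotomic r0) (bigD1_seq r) ?divisors_uniq //=; last first.
    by rewrite -dvdn_divisors.
  rewrite mulrCA; congr (_ * _).
  rewrite (bigID (fun d => d %| m)%N) /=; congr (_ * _).
  rewrite -(prod_Cyclotomic m0) -[RHS]big_filter -[LHS]big_filter.
  apply: perm_big; apply: uniq_perm; rewrite ?filter_uniq ?divisors_uniq // => d.
  rewrite !mem_filter -!dvdn_divisors //=.
  apply/andP/idP => [[/andP[] //]|dm].
  split; last by rewrite (dvdn_trans dm) // rE dvdn_mulr.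
  by rewrite dm andbT; apply: contraTneq dm => ->; rewrite gtnNdvd.
have Phi_dvd : exists T : {poly int}, 'X^r - 1 = 'Phi_r * T.
  exists (\prod_(d <- divisors r | d != r) 'Phi_d).
  rewrite -(prod_Cyclotomic r0) (bigD1_seq r) ?divisors_uniq //=.
  by rewrite -dvdn_divisors.
split.
  have [T /(congr1 (fun P => (Zto F P).[x]))] := Phi_dvd.
  rewrite rmorphM rmorphB rmorph1 /= map_polyXn hornerM (eqP rx) mul0r.
  by rewrite hornerD hornerN hornerC hornerXn => /eqP; rewrite subr_eq0 => /eqP.
apply: contra_neq qF => xm.
have [T /(congr1 (fun P => (Zto F P).[x]))] := PhiE.
rewrite rmorphM rmorph_sum /= hornerM (eqP rx) mul0r horner_sum => <-.
under eq_bigr => i _ do rewrite map_polyXn hornerXn exprM xm expr1n.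
by rewrite sumr_const card_ord.
Qed.

(** * Primes dividing cyclotomic values *)

Lemma exists_char_poly (R : comNzRingType) (h : {poly R}) :
  h \is monic -> (1 < size h)%N ->
  exists n (A : 'M[R]_n.+1), char_poly A = h /\ size h = n.+2.
Proof.
move=> h_mon h1.
have gen m (A : 'M[R]_m) : (0 < m)%N ->
    exists n (B : 'M[R]_n.+1), char_poly B = char_poly A /\ m = n.+1.
  by case: m A => // n A _; exists n, A.
have [|n [A [AE nE]]] := gen _ (companionmx h); first by rewrite -subn1 subn_gt0.
exists n, A; split; first by rewrite AE companionmxK.
by rewrite -nE prednK // ltnW.
Qed.

Lemma horner_char_poly (R : comNzRingType) n (A : 'M[R]_n) (x : R) :
  (char_poly A).[x] = \det (x%:M - A).
Proof.
rewrite -/(horner_eval x _) /char_poly -det_map_mx; congr (\det _).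
apply/matrixP => i j; rewrite !mxE rmorphB rmorphMn /=.
by rewrite /horner_eval hornerX hornerC.
Qed.

(** This is the product formula for the resultant of [char_poly A] and a polynomial with leading
    coefficient c and roots [s]. *)
Lemma det_horner_mx_prod (R : comNzRingType) n (A : 'M[R]_n.+1) (c : R) (s : seq R) :
  \det (horner_mx A (c *: \prod_(x <- s) ('X - x%:P))) =
  c ^+ n.+1 * \prod_(x <- s) ((-1) ^+ n.+1 * (char_poly A).[x]).
Proof.
rewrite linearZ /= detZ; congr (_ * _).
elim: s => [|x s IH]; first by rewrite !big_nil rmorph1 det1.
rewrite !big_cons rmorphM /= det_mulmx IH; congr (_ * _).
rewrite rmorphB /= horner_mx_X horner_mx_C horner_char_poly.
by rewrite -detZ scaleN1r opprB.
Qed.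

(** Evaluation at [A] kills [char_poly A] by Cayley-Hamilton, so u(A) g(A) is the identity modulo p
    and det g(A) is invertible modulo p. *)
Lemma det_horner_mx_Bezout (p n : nat) (A : 'M[int]_n.+1) (g u v w : {poly int}) :
  prime p -> u * g + v * char_poly A = 1 + p%:Z *: w ->
  ~~ (p %| \det (horner_mx A g))%Z.
Proof.
move=> p_pr /(congr1 (horner_mx A)).
rewrite !rmorphD !rmorphM /= Cayley_Hamilton mulr0 addr0 rmorph1 linearZ /=.
move=> /(congr1 (map_mx (intr : int -> 'F_p))) E.
rewrite (dvdz_pcharf (pchar_Fp p_pr)); apply/eqP => det0.
have : \det (map_mx (intr : int -> 'F_p) (horner_mx A u * horner_mx A g)) = 0.
  by rewrite det_map_mx /= det_mulmx rmorphM /= det0 mulr0.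
rewrite E map_mxD map_mxZ /= -pmulrn.
rewrite (pcharf0 (pchar_Fp p_pr)) scale0r addr0 map_mx1 det1 => /eqP.
by rewrite oner_eq0.
Qed.

(** Coprimality modulo p is expressed over the integers so that the identity can be evaluated both
    at integer matrices and at algebraic integers. *)
Definition Bezout_mod (p : nat) (g h : {poly int}) : Prop :=
  exists u v w : {poly int}, u * g + v * h = 1 + p%:Z *: w.

Lemma Cyclotomic_comp_monic (r k : nat) : (0 < k)%N -> 'Phi_r \Po 'X^k \is monic.
Proof.
move=> k0; rewrite monicE lead_coef_comp ?size_polyXn ?ltnS //.
by rewrite (monicP (Cyclotomic_monic r)) lead_coefXn expr1n mulr1.
Qed.

Lemma size_Cyclotomic_comp (r k : nat) : (0 < r)%N -> (0 < k)%N ->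
  size ('Phi_r \Po 'X^k) = (totient r * k).+1.
Proof.
move=> r0 k0; rewrite -(prednK (n := size _)); last first.
  by rewrite lt0n size_poly_eq0 monic_neq0 ?Cyclotomic_comp_monic.
by rewrite size_comp_poly size_Cyclotomic size_polyXn.
Qed.

(* [6 %| r] makes [1] a non-root of ['Phi_r] in every characteristic. *)
Lemma Bezout_mod_Cyclotomic (g : {poly int}) (r p : nat) :
  prime p -> Zto 'F_p g != 0 -> (0 < r)%N -> (6 %| r)%N ->
  exists2 N, (0 < N)%N & forall k, (0 < k)%N -> (N %| k)%N ->
    Bezout_mod p g ('Phi_r \Po 'X^k).
Proof.
move=> p_pr g0 r0 r6; have [F [pF [rs grs]]] := exists_splitting_finField _ _ p_pr g0.
have F1 := finNzRing_gt1 F.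
(* If [#|F|.-1] divides k, then x^k = 1 for every nonzero x in [F]. *)
exists #|F|.-1; first by rewrite -subn1 subn_gt0.
move=> k k0 Nk; have [[x _ hx]|//] := common_root_or_Bezout _ _ g ('Phi_r \Po 'X^k) _ pF grs.
exfalso; have {}hx : root (Zto F 'Phi_r) (x ^+ k).
  by move: hx; rewrite /root map_comp_poly map_polyXn horner_comp hornerXn.
(* One of 2 and 3 is nonzero in [F], and both divide r. *)
have [q [q1 qr qF]] : exists q, [/\ (1 < q)%N, (q %| r)%N & q%:R != 0 :> F].
  have [p2|p2] := eqVneq p 2%N; [exists 3%N|exists 2%N]; split=> //.
  - exact: dvdn_trans r6.
  - by rewrite -(dvdn_pcharf pF) p2.
  - exact: dvdn_trans r6.
  by rewrite -(dvdn_pcharf pF) dvdn_prime2.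
have [xr] := root_Cyclotomic_order _ _ _ _ r0 q1 qr qF hx.
have x0 : x != 0.
  apply: contra_eq_neq xr => ->.
  by rewrite -exprM expr0n muln_eq0 !gtn_eqF // eq_sym oner_neq0.
have xF : x ^+ #|F|.-1 = 1.
  by apply: (mulfI x0); rewrite -exprS prednK ?expf_card ?mulr1 // ltnW.
by have /dvdnP[m ->] := Nk; rewrite mulnC [x ^+ _]exprM xF !expr1n eqxx.
Qed.

Lemma Bezout_mod_Cyclotomic_small (g : {poly int}) (r B : nat) :
  (forall p, prime p -> Zto 'F_p g != 0) -> (0 < r)%N -> (6 %| r)%N ->
  exists2 N, (0 < N)%N & forall p k, prime p -> (p <= B)%N -> (0 < k)%N ->
    (N %| k)%N -> Bezout_mod p g ('Phi_r \Po 'X^k).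
Proof.
move=> g0 r0 r6; elim: B => [|B [N N0 NE]].
  by exists 1%N => // p k /prime_gt0; case: p.
have [B_pr|B_npr] := boolP (prime B.+1); last first.
  exists N => // p k p_pr; rewrite leq_eqVlt => /orP[/eqP pB|]; last exact: NE.
  by rewrite -pB p_pr in B_npr.
have [M M0 ME] := Bezout_mod_Cyclotomic g r _ B_pr (g0 _ B_pr) r0 r6.
exists (M * N)%N; first by rewrite muln_gt0 M0.
move=> p k p_pr; rewrite leq_eqVlt => /orP[/eqP-> k0 Mk|pB k0 Nk].
  by apply: ME => //; apply: dvdn_trans Mk; rewrite dvdn_mulr.
by apply: NE => //; apply: dvdn_trans Nk; rewrite dvdn_mull.
Qed.

Lemma exists_prime_not_Bezout (g : {poly int}) (mu : algC) (r B : nat) :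
  (forall p, prime p -> Zto 'F_p g != 0) -> root (Zto algC g) mu ->
  mu != 0 -> (forall n, (0 < n)%N -> mu ^+ n != 1) -> (0 < r)%N -> (6 %| r)%N ->
  exists p k, [/\ prime p, (B < p)%N, (0 < k)%N
    & ~ Bezout_mod p g ('Phi_r \Po 'X^k)].
Proof.
move=> g0 gmu mu0 mu1 r0 r6; apply: contrapT => noprime.
have [N N0 NE] := Bezout_mod_Cyclotomic_small g r B g0 r0 r6.
have allp p k : prime p -> (0 < k)%N -> (N %| k)%N -> Bezout_mod p g ('Phi_r \Po 'X^k).
  move=> p_pr k0 Nk; have [pB|pB] := leqP p B; first exact: NE.
  by apply: contrapT => nB; apply: noprime; exists p, k.
have [mus musE] := closed_field_poly_normal (Zto algC g).
set c := lead_coef _ in musE.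
have c0 : c != 0.
  rewrite lead_coef_eq0; apply: contraTneq (g0 2%N isT) => gC0; rewrite negbK.
  suff -> : g = 0 by rewrite rmorph0.
  by apply: (map_inj_poly (@intr_inj algC) (rmorph0 _)); rewrite gC0 rmorph0.
have mumus : mu \in mus.
  by move: gmu; rewrite musE rootZ // root_prod_XsubC.
pose Phi := Zto algC 'Phi_r; pose others := rem mu mus.
have [z zPhi] : exists z, root Phi z.
  apply/closed_rootP; rewrite size_map_poly_id0 ?size_Cyclotomic; last first.
    by rewrite (monicP (Cyclotomic_monic r)) rmorph1 oner_eq0.
  by rewrite eqSS -lt0n totient_gt0.
have z0 : z != 0.
  have r2 : (2 %| r)%N by apply: dvdn_trans r6.
  have two0 : 2%:R != 0 :> algC by rewrite pnatr_eq0.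
  have [zr _] := root_Cyclotomic_order _ r 2 _ r0 isT r2 two0 zPhi.
  by apply: contra_eq_neq zr => ->; rewrite expr0n gtn_eqF // eq_sym oner_neq0.
(* Here k = N (j + 1), shifted so that k is never 0; Phi(x^k) is still a polynomial in the j-th
   power of x^N. *)
pose V (x : algC) j := (Phi \Po (x ^+ N *: 'X)).[(x ^+ N) ^+ j].
have VE x j : V x j = Phi.[x ^+ (N * j.+1)].
  by rewrite /V horner_comp hornerZ hornerX -exprS -exprM.
pose C j := c ^+ (totient r * N) * (c ^+ (totient r * N)) ^+ j.
have CE j : C j = c ^+ (totient r * (N * j.+1)) by rewrite /C -exprS -exprM mulnA.
(* Up to sign the base is the resultant, an integer divisible by no prime. Squaring disposes of the
   sign. *)
have det1 j : (C j * (V mu j * \prod_(x <- others) V x j)) ^+ 2 = 1.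
  set k := (N * j.+1)%N.
  have k0 : (0 < k)%N by rewrite muln_gt0 N0.
  have [|n [A [AE szA]]] := exists_char_poly _ _ (Cyclotomic_comp_monic r k k0).
    by rewrite size_Cyclotomic_comp // ltnS muln_gt0 totient_gt0 r0.
  have nE : n.+1 = (totient r * k)%N by move: szA; rewrite size_Cyclotomic_comp // => -[].
  set R := \det (horner_mx A g).
  have R1 : `|R|%N = 1%N.
    apply/eqP; rewrite eqn_leq andbC lt0n absz_eq0.
    have nR p : prime p -> ~~ (p %| R)%Z.
      move=> p_pr; have [u [v [w]]] := allp p k p_pr k0 (dvdn_mulr _ (dvdnn _)).
      by rewrite -AE; apply: det_horner_mx_Bezout.
    have -> /= : R != 0 by apply: contraNneq (nR 2%N isT) => ->; rewrite dvdz0.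
    rewrite leqNgt; apply/negP => R1.
    by have := nR _ (pdiv_prime R1); rewrite dvdzE /= pdiv_dvd.
  have : (R%:~R : algC) ^+ 2 = 1.
    rewrite -rmorphXn /= (_ : R ^+ 2 = 1) //.
    by case: (R) R1 => [m|m] /=; case: m => [|[|m]].
  have -> : (R%:~R : algC) = c ^+ n.+1 * \prod_(x <- mus) ((-1) ^+ n.+1 * Phi.[x ^+ k]).
    rewrite /R -det_map_mx map_horner_mx musE det_horner_mx_prod; congr (_ * _).
    apply: eq_bigr => x _; rewrite -map_char_poly AE map_comp_poly map_polyXn.
    by rewrite horner_comp hornerXn.
  have -> : \prod_(x <- mus) ((-1) ^+ n.+1 * Phi.[x ^+ k]) =
      (-1) ^+ (n.+1 * size mus) * (V mu j * \prod_(x <- others) V x j).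
    rewrite big_split /= big_const_seq count_predT iter_mulr_1 -exprM.
    congr (_ * _); rewrite (perm_big _ (perm_to_rem mumus)) big_cons VE.
    by congr (_ * _); apply: eq_bigr => x _; rewrite VE.
  rewrite CE -nE mulrCA exprMn -exprM mulnC exprM sqrrN expr1n expr1n mul1r //.
(* Split off one factor Phi(mu^k) from the square; what remains is an exponential sum in j. Because
   of the shift by one, the root of Phi is divided by mu^N. *)
apply: (@expsum_not_inverse algC (Phi \Po (mu ^+ N *: 'X)) (mu ^+ N) (z / mu ^+ N)
  (fun j => C j * \prod_(x <- others) V x j * (C j * (V mu j * \prod_(x <- others) V x j)))).
- by rewrite /root horner_comp hornerZ hornerX mulrCA mulfV ?mulr1 ?expf_neq0.
- by rewrite mulf_neq0 ?invr_neq0 ?expf_neq0.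
- by rewrite expf_neq0.
- by move=> n n0; rewrite -exprM mu1 // muln_gt0 N0.
- have eV : expsum _ (fun j => \prod_(x <- others) V x j).
    by apply: expsum_prod => x; apply: expsum_horner.
  have eC : expsum _ C := expsum_geom _ _ _.
  have eP : expsum _ (V mu) := expsum_horner _ _ _.
  exact: expsumM (expsumM _ _ _ eC eV) (expsumM _ _ _ eC (expsumM _ _ _ eP eV)).
by move=> j; rewrite -[RHS](det1 j) -/(V mu j); ring.
Qed.

(** * Number fields inside algC *)

Local Notation integral := (integralOver intr).

Lemma integral_exp (K : fieldType) (x : K) n : integral x -> integral (x ^+ n).
Proof.
move=> ix; elim: n => [|n IH]; first exact: integral1.
by rewrite exprS; apply: integral_mul.
Qed.

Lemma integral_Zto_horner (K : fieldType) (G : {poly int}) (x : K) :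
  integral x -> integral (Zto K G).[x].
Proof.
move=> ix; apply: integral_horner => //; apply/integral_poly => i.
by rewrite coef_map; apply: integral_id.
Qed.

(** Multiplying the equation by a power of a, the coefficient of index n, gives a monic equation for
    a x. Since a may vanish, only the size of [A] is bounded. *)
Lemma integral_coef_mul_root (K : fieldType) (A : {poly K}) (n : nat) (x : K) :
  (size A <= n.+1)%N -> (forall i, integral A`_i) -> A.[x] = 0 ->
  integral (A`_n * x).
Proof.
case: n => [|n] sA iA.
  by rewrite (size1_polyC sA) hornerC coefC /= => ->; rewrite mul0r; apply: integral0.
set a := A`_n.+1 => Ax.
pose B : {poly K} := 'X^(n.+1) + \poly_(i < n.+1) (A`_i * a ^+ (n - i)).
have sB : (size (\poly_(i < n.+1) (A`_i * a ^+ (n - i)))%R < size ('X^(n.+1) : {poly K})%R)%N.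
  by rewrite size_polyXn ltnS size_poly.
apply: (@integral_root_monic _ _ _ _ B).
- by rewrite monicE lead_coefDl // lead_coefXn.
- rewrite /root hornerD hornerXn horner_poly; apply/eqP.
  transitivity (a ^+ n * A.[x]); last by rewrite Ax mulr0.
  rewrite (horner_coef_wide _ sA) mulr_sumr [RHS]big_ord_recr /= addrC.
  congr (_ + _); first by rewrite -/a exprMn exprSr mulrA.
  apply: eq_bigr => i _; have i_n : (i <= n)%N by rewrite -ltnS.
  have -> : a ^+ n = a ^+ (n - i) * a ^+ i by rewrite -exprD subnK.
  by rewrite exprMn; ring.
apply/integral_poly => i; rewrite coefD coefXn coef_poly.
apply: integral_add; first by case: eqP => _; [apply: integral1|apply: integral0].
case: ltnP => _; last exact: integral0.
by apply: integral_mul; last apply: integral_exp; apply: iA.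
Qed.

Local Notation QtoC := (map_poly (ratr : rat -> algC)).
Local Notation ZtoQ := (map_poly (intr : int -> rat)).

Lemma QtoC_ZtoQ (G : {poly int}) : QtoC (ZtoQ G) = Zto algC G.
Proof. by rewrite -map_poly_comp; apply: eq_map_poly => x /=; rewrite ratr_int. Qed.

(** Take the primitive part of the rational minimal polynomial: by Gauss's lemma divisibility over
    the rationals descends to the integers, and a polynomial of content 1 is nonzero modulo every
    prime. *)
Lemma exists_primitive_minpoly (x : algC) : exists g : {poly int},
  [/\ forall p, prime p -> Zto 'F_p g != 0, root (Zto algC g) x
    & forall G, root (Zto algC G) x -> exists H, G = g * H].
Proof.
have [P [_ P_mon PE]] := minCpolyP x.
have [q [a a0 qE]] := rat_poly_scale P.
have q0 : q != 0.
  apply: contraTneq P_mon => q0; rewrite qE q0 rmorph0 scaler0.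
  by rewrite monicE lead_coef0 eq_sym oner_neq0.
have a0' : a%:~R != 0 :> rat by rewrite intr_eq0.
have Zroot G : root (Zto algC G) x = (q %| G).
  by rewrite -QtoC_ZtoQ PE qE dvdpZl ?invr_neq0 // dvdp_rat_int.
exists (zprimitive q); split.
- move=> p p_pr; apply: contraTneq isT => /(map_poly_eq0_pchar _ _ _ (pchar_Fp p_pr)).
  case=> H HE; have := zcontents_primitive q; rewrite HE q0 zcontentsZ.
  move=> /(congr1 absz); rewrite abszM /= => /eqP.
  by rewrite muln_eq1 => /andP[/eqP p1]; rewrite p1 in p_pr.
- rewrite Zroot {1}(zpolyEprim q) dvdpZl ?dvdpp //.
  by rewrite zcontents_eq0.
by move=> G; rewrite Zroot => /dvdpP_int[H ->]; exists H.
Qed.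

Lemma exists_integral_multiple (x : algC) :
  exists2 D : int, D != 0 & integral (D%:~R * x).
Proof.
have [g [g0 gx _]] := exists_primitive_minpoly x.
exists (lead_coef g).
  by rewrite lead_coef_eq0; apply: contraTneq (g0 2%N isT) => ->; rewrite rmorph0 eqxx.
have -> : (lead_coef g)%:~R = (Zto algC g)`_(size g).-1 by rewrite coef_map.
apply: integral_coef_mul_root; last exact/eqP.
  by apply: leq_trans (size_poly _ _) _; apply: leqSpred.
by move=> i; rewrite coef_map; apply: integral_id.
Qed.

(** The leading coefficient of the primitive minimal polynomial divides that of a monic multiple,
    hence is a sign, which can be scaled away. *)
Lemma exists_monic_minpoly (theta : algC) : integral theta ->
  exists f : {poly int}, [/\ f \is monic, root (Zto algC f) theta
    & forall G, root (Zto algC G) theta -> exists H, G = f * H].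
Proof.
move=> [P P_mon Px]; have [g [_ gx gdvd]] := exists_primitive_minpoly theta.
have [H PE] := gdvd _ Px.
have := monicP P_mon; rewrite PE lead_coefM => lc1.
have lcg : lead_coef g * lead_coef g = 1.
  move/(congr1 absz)/eqP: lc1; rewrite abszM muln_eq1 => /andP[/eqP + _].
  by case: (lead_coef g) => [[|[|n]]|[|n]].
exists (lead_coef g *: g); split.
- by rewrite monicE lead_coefZ lcg.
- by rewrite map_polyZ /root hornerZ (eqP gx) mulr0.
move=> G /gdvd[K ->]; exists (lead_coef g *: K).
by rewrite -scalerAl -scalerAr scalerA lcg scale1r.
Qed.

(** The minimal polynomial is irreducible, hence coprime to [G] over the rationals; clear
    denominators in the Bezout identity. Thus a nonzero value G(theta) divides a nonzero integer in
    Z[theta]. *)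
Lemma minpoly_Bezout (theta : algC) (f G : {poly int}) :
  root (Zto algC f) theta ->
  (forall G, root (Zto algC G) theta -> exists H, G = f * H) ->
  ~~ root (Zto algC G) theta ->
  exists (N : int) (A H : {poly int}), N != 0 /\ H * G = N%:P + f * A.
Proof.
move=> fx fdvd Gx; have [P [_ P_mon PE]] := minCpolyP theta.
have co : coprimep P (ZtoQ G).
  have [e Pe] := dvdpP _ _ (dvdp_gcdl P (ZtoQ G)).
  have P0 := monic_neq0 P_mon.
  have : root (QtoC P) theta by rewrite PE.
  rewrite Pe rmorphM rootM /= !PE => /orP[Pdve|Pdvd].
    rewrite /coprimep.
    have e0 : e != 0 by apply: contraTneq P0; rewrite Pe => ->; rewrite mul0r eqxx.
    have d0 : gcdp P (ZtoQ G) != 0 by rewrite gcdp_eq0 negb_and P0.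
    have := dvdp_leq e0 Pdve; rewrite Pe size_mul -?Pe //.
    move: e0 d0; rewrite -!size_poly_gt0.
    move: (size (gcdp _ _)) (size e) => b a; lia.
  case/negP: Gx; rewrite -QtoC_ZtoQ PE; apply: dvdp_trans Pdvd _; exact: dvdp_gcdr.
have [[u v] /= uv1] := Bezout_eq1_coprimepP _ _ co.
have [H [N N0 vE]] := rat_poly_scale v.
have NC : (N%:~R : algC) != 0 by rewrite intr_eq0.
have : root (Zto algC (H * G - N%:P)) theta.
  have := congr1 (fun Q => (QtoC Q).[theta]) uv1.
  rewrite rmorphD !rmorphM rmorph1 /= hornerD !hornerM hornerC.
  have /eqP-> : root (QtoC P) theta by rewrite PE.
  rewrite mulr0 add0r QtoC_ZtoQ vE map_polyZ QtoC_ZtoQ hornerZ fmorphV /= ratr_int => E.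
  rewrite rmorphB rmorphM /= map_polyC /root hornerD hornerN hornerC hornerM.
  by rewrite -mulrA in E; rewrite (canRL (mulVKf NC) E) mulr1 /= subrr.
by case/fdvd => A AE; exists N, A, H; split=> //; rewrite -AE [RHS]addrC subrK.
Qed.

(** The derivative is nonzero of smaller degree, so it does not vanish at theta. The integer N plays
    the part of the discriminant: [f] is separable modulo every prime not dividing it. *)
Lemma minpoly_separable (theta : algC) (f : {poly int}) :
  f \is monic -> root (Zto algC f) theta ->
  (forall G, root (Zto algC G) theta -> exists H, G = f * H) ->
  exists (N : int) (A H : {poly int}), N != 0 /\ H * f^`() = N%:P + f * A.
Proof.
move=> f_mon fx fdvd; apply: (minpoly_Bezout theta) => //.
apply/negP => f'x; have [H fE] := fdvd _ f'x.
have f1 : (1 < size f)%N.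
  rewrite ltnNge; apply: contraL fx => /size1_polyC fC.
  have := monicP f_mon; rewrite fC lead_coefC => ->.
  by rewrite rmorph1 /root hornerC oner_eq0.
have f0 : f != 0 by rewrite monic_neq0.
have f'0 : f^`() != 0.
  apply: contra_neq (oner_neq0 int) => /(congr1 (fun Q : {poly int} => Q`_(size f).-2)).
  rewrite coef_deriv coef0 prednK -1?subn1 ?subn_gt0 // subn1.
  rewrite -/(lead_coef f) (monicP f_mon) => /eqP.
  by rewrite pnatr_eq0 -subn1 subn_eq0 leqNgt f1.
have H0 : H != 0 by apply: contraTneq f'0 => H0; rewrite fE H0 mulr0 eqxx.
have := lt_size_deriv f0; rewrite fE size_mul //.
by move: H0; rewrite -size_poly_gt0; move: (size H) (size f) => b c; lia.
Qed.

(** Membership in Q(theta) for algebraic theta, with the denominator cleared so that the numerator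
    can be reduced modulo primes. *)
Definition in_Q (theta x : algC) : Prop := exists (D : int) (G : {poly int}),
  D != 0 /\ D%:~R * x = (Zto algC G).[theta].

Lemma in_QP (theta x : algC) :
  in_Q theta x <-> exists P : {poly rat}, x = (QtoC P).[theta].
Proof.
split=> [[D [G [D0 DE]]]|[P ->]].
  exists (D%:~R^-1 *: ZtoQ G); rewrite map_polyZ hornerZ QtoC_ZtoQ -DE fmorphV /= ratr_int.
  by rewrite mulKf // intr_eq0.
have [G [D D0 PE]] := rat_poly_scale P; exists D, G; split=> //.
by rewrite PE map_polyZ hornerZ QtoC_ZtoQ fmorphV /= ratr_int mulVKf // intr_eq0.
Qed.

Lemma in_QD (theta x y : algC) : in_Q theta x -> in_Q theta y -> in_Q theta (x + y).
Proof.
move=> /in_QP[P ->] /in_QP[Q ->]; apply/in_QP; exists (P + Q).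
by rewrite rmorphD hornerD.
Qed.

Lemma in_QM (theta x y : algC) : in_Q theta x -> in_Q theta y -> in_Q theta (x * y).
Proof.
move=> /in_QP[P ->] /in_QP[Q ->]; apply/in_QP; exists (P * Q).
by rewrite rmorphM hornerM.
Qed.

Lemma in_Q_ratr (theta : algC) (q : rat) : in_Q theta (ratr q).
Proof. by apply/in_QP; exists q%:P; rewrite map_polyC hornerC. Qed.

Lemma in_QV (theta x : algC) : integral theta -> in_Q theta x -> in_Q theta x^-1.
Proof.
move=> itheta [D [G [D0 DE]]]; have [->|x0] := eqVneq x 0.
  by rewrite invr0 -(rmorph0 (ratr : rat -> algC)); apply: in_Q_ratr.
have [f [_ fx fdvd]] := exists_monic_minpoly _ itheta.
have DC : D%:~R != 0 :> algC by rewrite intr_eq0.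
have Gx : ~~ root (Zto algC G) theta by rewrite /root -DE mulf_neq0.
have [N [A [H [N0 /(congr1 (fun Q => (Zto algC Q).[theta]))]]]] :=
  minpoly_Bezout _ _ _ fx fdvd Gx.
rewrite rmorphM rmorphD rmorphM /= hornerM hornerD hornerM (eqP fx) mul0r addr0.
rewrite map_polyC hornerC -DE => HE; exists N, (D *: H); split=> //.
rewrite map_polyZ hornerZ -HE; apply: (mulIf x0); rewrite mulfVK //.
by rewrite mulrCA mulrA.
Qed.

Lemma exists_primitive_element (s : seq algC) : exists theta : algC,
  integral theta /\ forall x, x \in s -> in_Q theta x.
Proof.
have [z _ [ps sE]] := algC_PET s.
have [D D0 iDz] := exists_integral_multiple z.
exists (D%:~R * z); split=> // x; rewrite sE => /mapP[P _ ->].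
apply/in_QP; exists (P \Po (D%:~R^-1 *: 'X)); rewrite map_comp_poly horner_comp.
rewrite map_polyZ map_polyX hornerZ hornerX fmorphV /= ratr_int mulKf //.
by rewrite intr_eq0.
Qed.

(** * The local ring at an unramified prime *)

Section Residue.
Variables (theta : algC) (f : {poly int}) (p : nat) (F : finFieldType) (alpha : F).

(* [x] lies in the localization of Z[theta] at the kernel of [theta |-> alpha],
   and its image in the residue field is [b]. *)
Definition residue (x : algC) (b : F) : Prop := exists S G : {poly int},
  [/\ (Zto F S).[alpha] != 0, (Zto algC S).[theta] * x = (Zto algC G).[theta]
    & (Zto F S).[alpha] * b = (Zto F G).[alpha]].

Definition local_integer (x : algC) : Prop := exists b, residue x b.

Definition local_unit (x : algC) : Prop := exists2 b, residue x b & b != 0.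

(* [F] will be a splitting field of [f] modulo [p].  The last condition says that
   Z[theta] / p is fixed by the power [#|F|]: this is how [p] being unramified
   is used. *)
Definition unramified_point : Prop :=
  [/\ p \in [pchar F], root (Zto algC f) theta,
      (forall G, root (Zto algC G) theta -> exists H, G = f * H),
      root (Zto F f) alpha
    & (forall G : {poly int}, exists A B : {poly int},
         G ^+ #|F| - G = f * A + p%:Z *: B)].

Hypothesis ramP : unramified_point.

Let pF : p \in [pchar F]. Proof. by case: ramP. Qed.
Let p_pr : prime p. Proof. exact: pcharf_prime pF. Qed.
Let pC0 : p%:R != 0 :> algC. Proof. by rewrite pnatr_eq0 -lt0n prime_gt0. Qed.

Lemma horner_alpha_eq0 (G : {poly int}) :
  (Zto algC G).[theta] = 0 -> (Zto F G).[alpha] = 0.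
Proof.
have [_ _ fdvd fa _] := ramP; move=> /eqP/fdvd[H ->].
by rewrite rmorphM hornerM (eqP fa) mul0r.
Qed.

Lemma residue_uniq (x : algC) (b c : F) : residue x b -> residue x c -> b = c.
Proof.
move=> [S [G [S0 SG Sb]]] [T [H [T0 TH Tc]]].
have : (Zto F (T * G - S * H)).[alpha] = 0.
  apply: horner_alpha_eq0; rewrite rmorphB !rmorphM /= hornerD hornerN !hornerM.
  by rewrite -SG -TH; ring.
rewrite rmorphB !rmorphM /= hornerD hornerN !hornerM -Sb -Tc.
move=> E; apply: (mulfI (mulf_neq0 S0 T0)); apply/eqP; rewrite -subr_eq0.
by rewrite -[X in _ == X]E; apply/eqP; ring.
Qed.

Lemma residueD (x y : algC) (b c : F) :
  residue x b -> residue y c -> residue (x + y) (b + c).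
Proof.
move=> [S [G [S0 SG Sb]]] [T [H [T0 TH Tc]]]; exists (S * T), (G * T + H * S).
rewrite !(rmorphD, rmorphM) /= !(hornerD, hornerM) -SG -TH -Sb -Tc.
by split; [rewrite mulf_neq0|ring|ring].
Qed.

Lemma residueM (x y : algC) (b c : F) :
  residue x b -> residue y c -> residue (x * y) (b * c).
Proof.
move=> [S [G [S0 SG Sb]]] [T [H [T0 TH Tc]]]; exists (S * T), (G * H).
rewrite !rmorphM /= !hornerM -SG -TH -Sb -Tc.
by split; [rewrite mulf_neq0|ring|ring].
Qed.

Lemma residue_horner (G : {poly int}) :
  residue (Zto algC G).[theta] (Zto F G).[alpha].
Proof. by exists 1, G; rewrite !rmorph1 !hornerC !mul1r oner_neq0. Qed.

Lemma residue_int (z : int) : residue z%:~R z%:~R.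
Proof. by have := residue_horner z%:P; rewrite !map_polyC !hornerC. Qed.

Lemma residue0 : residue 0 0. Proof. exact: (residue_int 0). Qed.

Lemma residue1 : residue 1 1. Proof. exact: (residue_int 1). Qed.

Lemma residue_nat (n : nat) : residue n%:R n%:R.
Proof. by have := residue_int n; rewrite -!pmulrn. Qed.

Lemma residueN (x : algC) (b : F) : residue x b -> residue (- x) (- b).
Proof.
by move=> xb; have := residueM _ _ _ _ (residue_int (-1)) xb; rewrite !rmorphN1 !mulN1r.
Qed.

Lemma residueB (x y : algC) (b c : F) :
  residue x b -> residue y c -> residue (x - y) (b - c).
Proof. by move=> xb /residueN; apply: residueD. Qed.

Lemma residueX (x : algC) (b : F) n : residue x b -> residue (x ^+ n) (b ^+ n).
Proof.
move=> xb; elim: n => [|n IH]; first exact: residue1.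
by rewrite !exprS; apply: residueM.
Qed.

Lemma residue_sum (n : nat) (x : 'I_n -> algC) (b : 'I_n -> F) :
  (forall i, residue (x i) (b i)) -> residue (\sum_i x i) (\sum_i b i).
Proof.
move=> xb; elim/big_ind2: _ => //; [exact: residue0|].
by move=> *; apply: residueD.
Qed.

Lemma residue_neq0 (x : algC) (b : F) : residue x b -> b != 0 -> x != 0.
Proof.
by move=> xb; apply: contra_neq => x0; rewrite x0 in xb; apply: residue_uniq xb residue0.
Qed.

Lemma residueV (x : algC) (b : F) : residue x b -> b != 0 -> residue x^-1 b^-1.
Proof.
move=> xb b0; have x0 := residue_neq0 _ _ xb b0.
have [S [G [S0 SG Sb]]] := xb; exists G, S; split.
- by rewrite -Sb mulf_neq0.
- by rewrite -SG mulfK.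
- by rewrite -Sb mulfK.
Qed.

Lemma residueXz (x : algC) (b : F) (z : int) :
  residue x b -> b != 0 -> residue (x ^ z) (b ^ z).
Proof.
case: z => n xb b0; first exact: residueX.
by rewrite !NegzE -!invr_expz; apply: residueV; [apply: residueX|rewrite expf_neq0].
Qed.

Lemma residue_mulp (x : algC) : local_integer x -> residue (p%:R * x) 0.
Proof.
move=> [b xb]; have := residueM _ _ _ _ (residue_nat p) xb.
by rewrite (pcharf0 pF) mul0r.
Qed.

(** This makes p a uniformizer. When G(alpha) = 0, the factor 1 - G^(q-1), with q = [#|F|], is 1 at
    alpha and may be put into the denominator; the numerator becomes G - G^q, whose value at theta
    is a multiple of p because p is unramified. *)
Lemma residue0_divp (x : algC) :
  residue x 0 -> exists2 y, local_integer y & x = p%:R * y.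
Proof.
move=> [S [G [S0 SG]]]; rewrite mulr0 => /esym G0.
have [_ fx _ fa frob] := ramP; have [A [B AB]] := frob G.
pose T := S * (1 - G ^+ #|F|.-1).
have F1 := finNzRing_gt1 F.
have Ta : (Zto F T).[alpha] = (Zto F S).[alpha].
  rewrite rmorphM rmorphB rmorph1 rmorphXn /= hornerM hornerD hornerN hornerC.
  rewrite horner_exp G0 expr0n -subn1 subn_eq0 leqNgt F1 /=.
  by rewrite subr0 mulr1.
have Tx : (Zto algC T).[theta] * x = - (p%:R * (Zto algC B).[theta]).
  have := congr1 (fun Q => (Zto algC Q).[theta]) AB.
  rewrite rmorphB rmorphXn rmorphD rmorphM /= map_polyZ /=.
  rewrite !hornerD hornerN hornerM (eqP fx) mul0r add0r hornerZ -pmulrn => <-.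
  rewrite rmorphM rmorphB rmorph1 rmorphXn /= hornerM mulrAC SG.
  rewrite hornerD !hornerN hornerC !horner_exp mulrBr mulr1 -exprS prednK; last exact: ltnW.
  by rewrite opprB.
exists (x / p%:R); last by rewrite mulrC divfK.
exists (- (Zto F B).[alpha] / (Zto F S).[alpha]), T, (- B); split.
- by rewrite Ta.
- by rewrite mulrA Tx rmorphN hornerN mulNr mulrC mulKf.
- by rewrite Ta mulrC divfK // rmorphN hornerN.
Qed.

Lemma local_unit_neq0 (x : algC) : local_unit x -> x != 0.
Proof. by case=> b; apply: residue_neq0. Qed.

Lemma local_unitM (x y : algC) : local_unit x -> local_unit y -> local_unit (x * y).
Proof.
by move=> [b xb b0] [c yc c0]; exists (b * c); [apply: residueM|rewrite mulf_neq0].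
Qed.

Lemma local_unitV (x : algC) : local_unit x -> local_unit x^-1.
Proof. by move=> [b xb b0]; exists b^-1; [apply: residueV|rewrite invr_eq0]. Qed.

Lemma local_unitXz (x : algC) (z : int) : local_unit x -> local_unit (x ^ z).
Proof.
by move=> [b xb b0]; exists (b ^ z); [apply: residueXz|rewrite expfz_neq0].
Qed.

Lemma local_unit_int (z : int) : ~~ (p %| z)%Z -> local_unit z%:~R.
Proof. by move=> pz; exists z%:~R; [apply: residue_int|rewrite -(dvdz_pcharf pF)]. Qed.

(** The normalized valuation of the local ring, as a relation; it is normalized because p is a
    uniformizer. *)
Definition has_ord (x : algC) (k : int) : Prop :=
  exists2 u, local_unit u & x = p%:R ^ k * u.

Lemma has_ord_unit (x : algC) : local_unit x -> has_ord x 0.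
Proof. by move=> ux; exists x; rewrite ?expr0z ?mul1r. Qed.

Lemma has_ord_neq0 (x : algC) (k : int) : has_ord x k -> x != 0.
Proof. by case=> u /local_unit_neq0 u0 ->; rewrite mulf_neq0 ?expfz_neq0. Qed.

Lemma has_ordM (x y : algC) (k l : int) :
  has_ord x k -> has_ord y l -> has_ord (x * y) (k + l).
Proof.
move=> [u uu ->] [v uv ->]; exists (u * v); first exact: local_unitM.
by rewrite expfzDr //; ring.
Qed.

Lemma has_ordV (x : algC) (k : int) : has_ord x k -> has_ord x^-1 (- k).
Proof.
move=> [u uu ->]; exists u^-1; first exact: local_unitV.
by rewrite invfM invr_expz.
Qed.

Lemma has_ord_ge0 (x : algC) (n : nat) : has_ord x n -> local_integer x.
Proof.
move=> [u [b ub _] ->]; exists (p%:R ^+ n * b).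
by apply: residueM => //; apply: residueX; apply: residue_nat.
Qed.

Lemma has_ord_gt0 (x : algC) (n : nat) : has_ord x n.+1 -> residue x 0.
Proof.
move=> [u [b ub _] ->]; rewrite -exprnP exprS -mulrA; apply: residue_mulp.
by exists (p%:R ^+ n * b); apply: residueM => //; apply: residueX; apply: residue_nat.
Qed.

Lemma has_ord_uniq (x : algC) (k l : int) : has_ord x k -> has_ord x l -> k = l.
Proof.
suff le m n : has_ord x m -> has_ord x n -> m <= n.
  by move=> xk xl; apply/eqP; rewrite eq_le !le.
move=> xm xn; rewrite leNgt; apply/negP => nm.
have := has_ordM _ _ _ _ xm (has_ordV _ _ xn).
have x0 := has_ord_neq0 _ _ xm; rewrite divff //.
case E: (m - n) => [[|e]|e]; [lia| |lia].
by move=> /has_ord_gt0 /(residue_uniq _ _ _ residue1) /eqP; rewrite oner_eq0.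
Qed.

(** If x is not a unit, a factor p can be removed from both x and N, and the absolute value of N
    decreases. *)
Lemma has_ord_dvd_int (x y : algC) (N : int) :
  local_integer x -> local_integer y -> N != 0 -> x * y = N%:~R ->
  exists n : nat, has_ord x n.
Proof.
have [m] := ubnP `|N|%N; elim: m N x y => // m IH N x y + [b xb] ly N0 xy.
rewrite ltnS => Nm; have [b0|b0] := eqVneq b 0; last first.
  by exists 0%N; apply: has_ord_unit; exists b.
rewrite b0 in xb; have [x1 lx1 xE] := residue0_divp _ xb.
have [c yc] := ly.
have : (p %| N)%Z.
  rewrite (dvdz_pcharf pF); apply/eqP; apply: residue_uniq (residue_int N) _.
  by rewrite -xy -[X in residue _ X](mul0r c); apply: residueM.
case/dvdzP => M NE.
have M0 : M != 0 by apply: contra_neq N0 => M0; rewrite NE M0 mul0r.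
have [||n [u uu x1E]] := IH M x1 y _ lx1 ly M0.
- apply: leq_trans Nm; rewrite NE abszM ltn_Pmulr ?prime_gt1 //.
  by rewrite lt0n absz_eq0.
- apply: (mulfI pC0); rewrite mulrA -xE xy NE rmorphM /= -pmulrn mulrC //.
by exists n.+1, u; rewrite // xE x1E mulrA -!exprnP -exprS.
Qed.

Lemma has_ord_exists (x : algC) : in_Q theta x -> x != 0 -> exists k, has_ord x k.
Proof.
move=> [D [G [D0 DE]]] x0; have [_ fx fdvd _ _] := ramP.
have DC : D%:~R != 0 :> algC by rewrite intr_eq0.
have Gx : ~~ root (Zto algC G) theta by rewrite /root -DE mulf_neq0.
have [N [A [H [N0 /(congr1 (fun Q => (Zto algC Q).[theta]))]]]] :=
  minpoly_Bezout _ _ _ fx fdvd Gx.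
rewrite rmorphM rmorphD rmorphM /= hornerM hornerD hornerM (eqP fx) mul0r addr0.
rewrite map_polyC hornerC mulrC => GH.
have [||n Gn] := has_ord_dvd_int _ _ N _ _ N0 GH.
- by exists (Zto F G).[alpha]; apply: residue_horner.
- by exists (Zto F H).[alpha]; apply: residue_horner.
have [||m Dm] := has_ord_dvd_int D%:~R 1 D _ _ D0 (mulr1 _).
- by exists D%:~R; apply: residue_int.
- by exists 1; apply: residue1.
exists (n%:Z - m%:Z); have -> : x = (Zto algC G).[theta] / D%:~R by rewrite -DE mulrC mulKf.
by apply: has_ordM => //; apply: has_ordV.
Qed.

(** If x had negative order, its inverse would have residue 0, and a monic equation divided by the
    top power of x would read 1 = 0 in [F]. *)
Lemma integral_local_integer (x : algC) : in_Q theta x -> integral x -> local_integer x.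
Proof.
move=> Qx [P P_mon Px]; have [->|x0] := eqVneq x 0; first by exists 0; apply: residue0.
have [[n|n] xn] := has_ord_exists _ Qx x0; first exact: has_ord_ge0 xn.
have y0 : residue x^-1 0.
  by have := has_ordV _ _ xn; rewrite NegzE opprK; apply: has_ord_gt0.
have sP : size (Zto algC P) = (size P).-1.+1.
  rewrite prednK ?size_poly_gt0 ?monic_neq0 // size_map_poly_id0 //.
  by rewrite (monicP P_mon) oner_eq0.
have : residue ((Zto algC P).[x] * x^-1 ^+ (size P).-1) 1.
  rewrite horner_coef sP big_ord_recr /= mulrDl coef_map -/(lead_coef P) (monicP P_mon).
  rewrite mul1r -exprMn mulfV // expr1n -[X in residue _ X]add0r.
  apply: residueD; last exact: residue1.
  have sum0 : 0 = \sum_(i < (size P).-1) 0 :> F by rewrite big1.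
  rewrite mulr_suml [X in residue _ X]sum0.
  apply: residue_sum => i; rewrite coef_map.
  have -> : x^-1 ^+ (size P).-1 = x^-1 ^+ i * x^-1 ^+ ((size P).-1 - i).
    by rewrite -exprD subnKC // ltnW.
  rewrite mulrA -[X in residue (X * _)]mulrA -exprMn mulfV // expr1n mulr1.
  rewrite -(mulr0 ((P`_i)%:~R : F)); apply: residueM; first exact: residue_int.
  have := residueX _ _ ((size P).-1 - i) y0.
  by rewrite expr0n gtn_eqF // subn_gt0.
rewrite (eqP Px) mul0r => /(residue_uniq _ _ _ residue0)/esym/eqP.
by rewrite oner_eq0.
Qed.

Lemma local_unit_of_inverses (x : algC) (D E : int) (G H : {poly int}) :
  x != 0 -> ~~ (p %| D)%Z -> ~~ (p %| E)%Z ->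
  D%:~R * x = (Zto algC G).[theta] -> E%:~R * x^-1 = (Zto algC H).[theta] ->
  local_unit x.
Proof.
move=> x0 pD pE DG EH.
have div D' G' y : ~~ (p %| D')%Z -> D'%:~R * y = (Zto algC G').[theta] ->
    exists b, residue y b.
  move=> pD' E'; exists ((D'%:~R)^-1 * (Zto F G').[alpha]), D'%:P, G'.
  have D'0 : D'%:~R != 0 :> F by rewrite -(dvdz_pcharf pF).
  by rewrite !map_polyC !hornerC; split; rewrite // mulVKf.
have [b xb] := div _ _ _ pD DG; have [c yc] := div _ _ _ pE EH.
exists b => //; apply/eqP => b0.
have := residueM _ _ _ _ xb yc; rewrite b0 mul0r mulfV //.
by move=> /(residue_uniq _ _ _ residue1)/eqP; rewrite oner_eq0.
Qed.

(** The expansion of the power feeds the induction for the sum. The case of interest is n = p odd: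
    since p divides ['C(p, 2)], the sum is p modulo p^2. *)
Lemma geometric_sum_mod_sqr (z t : algC) (n : nat) :
  local_integer t -> z = 1 + p%:R * t -> exists s s', [/\ local_integer s,
    local_integer s', z ^+ n = 1 + n%:R * (p%:R * t) + p%:R ^+ 2 * s &
    \sum_(i < n) z ^+ i = n%:R + 'C(n, 2)%:R * (p%:R * t) + p%:R ^+ 2 * s'].
Proof.
move=> [b tb] zE; have l0 : local_integer 0 by exists 0; apply: residue0.
elim: n => [|n [s [s' [[c sc] [d s'd] znE sumE]]]].
  by exists 0, 0; rewrite big_ord0 expr0 !mul0r !mulr0 !addr0; split.
exists (s + n%:R * t * t + p%:R * t * s), (s' + s); split.
- exists (c + n%:R * b * b + p%:R * b * c).
  by do !apply: residueD => //; do !apply: residueM => //; apply: residue_nat.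
- by exists (d + c); apply: residueD.
- by rewrite exprSr znE zE -natr1; ring.
- rewrite big_ord_recr /= sumE znE binS bin1 natrD -natr1; ring.
Qed.

Lemma residue_sub1_divp (z : algC) : residue z 1 ->
  exists2 t, local_integer t & z = 1 + p%:R * t.
Proof.
move=> z1; have := residueB _ _ _ _ z1 residue1; rewrite subrr => /residue0_divp[t lt E].
by exists t; rewrite // -E addrC subrK.
Qed.

(** Lifting the exponent. If p does not divide m, the cofactor of z - 1 in z^m - 1 has residue m,
    hence is a unit. Otherwise induct on m / p: the remaining cofactor is p times an element of
    residue 1, by [geometric_sum_mod_sqr]. *)
Lemma has_ord_expr_sub1 (z : algC) (k : int) (m : nat) : (2 < p)%N -> (0 < m)%N ->
  residue z 1 -> has_ord (z - 1) k -> has_ord (z ^+ m - 1) (k + logn p m).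
Proof.
move=> p2 m0 z1 zk; have [n] := ubnP m; elim: n m m0 => // n IH m m0.
rewrite ltnS => mn.
have [pm|pm] := boolP (p %| m)%N; last first.
  rewrite subrX1 lognE (negPf pm) !andbF addr0 -[k]addr0; apply: has_ordM => //.
  apply: has_ord_unit; exists (\sum_(i < m) 1).
    by apply: residue_sum => i; rewrite -(expr1n _ i); apply: residueX.
  by rewrite sumr_const card_ord -(dvdn_pcharf pF).
have mE := divnK pm; set q := (m %/ p)%N in mE.
have q0 : (0 < q)%N by rewrite divn_gt0 ?prime_gt0 // dvdn_leq.
have qm : (q < n)%N by apply: leq_trans mn; rewrite -mE ltn_Pmulr ?prime_gt1.
have := IH q q0 qm; set y := z ^+ q => yk.
have y1 : residue y 1 by rewrite -(expr1n _ q); apply: residueX.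
have -> : logn p m = (logn p q + 1)%N.
  by rewrite -mE (lognM p q0 (prime_gt0 p_pr)) (logn_prime p p_pr) eqxx.
rewrite -mE exprM -/y subrX1 PoszD addrA; apply: has_ordM => //.
have [t lt yE] := residue_sub1_divp _ y1.
have [_ [s [_ [c sc] _ ->]]] := geometric_sum_mod_sqr _ _ p lt yE.
have /dvdnP[e ->] : (p %| 'C(p, 2))%N by apply: prime_dvd_bin.
exists (1 + p%:R * (e%:R * t + s)); last by rewrite expr1z natrM; ring.
exists 1; rewrite ?oner_neq0 // -[X in residue _ X]addr0.
apply: residueD; first exact: residue1.
apply: residue_mulp; have [b tb] := lt; exists (e%:R * b + c).
by apply: residueD => //; apply: residueM => //; apply: residue_nat.
Qed.

End Residue.

Arguments residue0 {theta F alpha}.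
Arguments residue1 {theta F alpha}.
Arguments residue_int {theta F alpha}.
Arguments residue_nat {theta F alpha}.
Arguments residueD {theta F alpha x y b c}.
Arguments residueM {theta F alpha x y b c}.
Arguments residueB {theta F alpha x y b c}.
Arguments residueX {theta F alpha x b}.
Arguments residue_uniq {theta f p F alpha} _ {x b c}.
Arguments residue_neq0 {theta f p F alpha} _ {x b}.
Arguments residueV {theta f p F alpha} _ {x b}.
Arguments residueXz {theta f p F alpha} _ {x b}.
Arguments residue_mulp {theta f p F alpha} _ {x}.
Arguments residue0_divp {theta f p F alpha} _ {x}.
Arguments local_unit_neq0 {theta f p F alpha} _ {x}.
Arguments local_unitM {theta F alpha x y}.
Arguments local_unitXz {theta f p F alpha} _ {x}.
Arguments local_unit_int {theta f p F alpha} _ {z}.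
Arguments has_ord_neq0 {theta f p F alpha} _ {x k}.
Arguments has_ordM {theta f p F alpha} _ {x y k l}.
Arguments has_ordV {theta f p F alpha} _ {x k}.
Arguments has_ord_uniq {theta f p F alpha} _ {x k l}.
Arguments has_ord_gt0 {theta f p F alpha} _ {x n}.
Arguments has_ord_exists {theta f p F alpha} _ {x}.
Arguments integral_local_integer {theta f p F alpha} _ {x}.
Arguments residue_sub1_divp {theta f p F alpha} _ {z}.
Arguments has_ord_expr_sub1 {theta f p F alpha} _ {z k m}.

(** * Existence of unramified primes *)

(** The homogenization of P: for b nonzero it is P(a / b) with denominators cleared, and for b = 0
    it picks out the top coefficient. *)
Definition homog (R : comNzRingType) (P : {poly int}) (a b : R) : R :=
  \sum_(i < size P) (P`_i)%:~R * a ^+ i * b ^+ ((size P).-1 - i).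

Lemma homog_horner (K : fieldType) (P A B : {poly int}) (x : K) :
  (Zto K (homog _ P A B)).[x] = homog _ P (Zto K A).[x] (Zto K B).[x].
Proof.
rewrite rmorph_sum horner_sum; apply: eq_bigr => i _.
by rewrite !rmorphM !rmorphXn /= rmorph_int !hornerM !horner_exp -(rmorph_int polyC) hornerC.
Qed.

Lemma homog_mul (K : fieldType) (P : {poly int}) (x b : K) :
  homog _ P (x * b) b = b ^+ (size P).-1 * \sum_(i < size P) (P`_i)%:~R * x ^+ i.
Proof.
rewrite mulr_sumr; apply: eq_bigr => i _.
have -> : b ^+ (size P).-1 = b ^+ i * b ^+ ((size P).-1 - i).
  by rewrite -exprD subnKC // -ltnS (leq_trans (ltn_ord i)) ?leqSpred.
by rewrite exprMn; ring.
Qed.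

Lemma horner_Zto (K : fieldType) (P : {poly int}) (x : K) :
  (Zto K P).[x] = \sum_(i < size P) (P`_i)%:~R * x ^+ i.
Proof.
rewrite (horner_coef_wide _ (size_poly _ _)); apply: eq_bigr => i _.
by rewrite coef_map.
Qed.

Lemma homog_0 (R : comNzRingType) (P : {poly int}) (a : R) :
  P \is monic -> homog _ P a 0 = a ^+ (size P).-1.
Proof.
move=> P_mon; have sP : size P = (size P).-1.+1.
  by rewrite prednK // size_poly_gt0 monic_neq0.
rewrite /homog sP big_ord_recr /= -/(lead_coef P) (monicP P_mon) subnn mul1r mulr1.
by rewrite big1 ?add0r // => i _; rewrite expr0n gtn_eqF ?mulr0 // subn_gt0.
Qed.

(* A Bezout identity at [theta] modulo [p] makes [h(mu)] invertible modulo [p] in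
   the algebraic integers.  Integral equations turn this into a polynomial
   vanishing at [mu], hence divisible by [g], which takes the value [1] at the
   common root of [g] and [h] modulo [p]. *)
Lemma lying_over (theta mu : algC) (f g h M : {poly int}) (D : int) (p : nat)
    (F : finFieldType) (rs : seq F) :
  integral theta -> root (Zto algC f) theta ->
  (forall G, root (Zto algC G) mu -> exists H, G = g * H) ->
  (forall p, prime p -> Zto 'F_p g != 0) -> h \is monic ->
  D%:~R * mu = (Zto algC M).[theta] -> p \in [pchar F] -> ~~ (p %| D)%Z ->
  Zto F f %= \prod_(x <- rs) ('X - x%:P) -> ~ Bezout_mod p g h ->
  exists2 alpha : F, root (Zto F f) alpha &
    root (Zto F h) ((Zto F M).[alpha] / D%:~R).
Proof.
move=> itheta ftheta gdvd g0 h_mon DM pF pD frs nBez; have p_pr := pcharf_prime pF.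
have DF : D%:~R != 0 :> F by rewrite -(dvdz_pcharf pF).
have [F1 [pF1 [rs1 grs1]]] := exists_splitting_finField _ _ p_pr (g0 p p_pr).
have [[a ga ha]|//] := common_root_or_Bezout _ _ _ h _ pF1 grs1.
(* The value of [Psi] at theta is h(mu) times a power of D. Over [F], where D is nonzero, a common
   root of [f] and [Psi] is the desired alpha. *)
pose Psi := homog _ h M D%:P.
have [[x fx Psix]|[u [v [w uvw]]]] := common_root_or_Bezout _ _ _ Psi _ pF frs.
  exists x => //; move: Psix; rewrite /root homog_horner map_polyC hornerC /=.
  by rewrite -{1}[X in homog _ _ X _](divfK DF) homog_mul -horner_Zto mulf_eq0 expf_eq0 (negPf DF) andbF.
exfalso.
pose e := (size h).-1.
have PsiE : (Zto algC Psi).[theta] = D%:~R ^+ e * (Zto algC h).[mu].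
  by rewrite homog_horner map_polyC hornerC /= -DM mulrC homog_mul -horner_Zto.
set V := (Zto algC v).[theta]; set W := (Zto algC w).[theta].
have iV : integral V by apply: integral_Zto_horner.
have iW : integral W by apply: integral_Zto_horner.
set Y := (Zto algC Psi).[theta] in PsiE.
have iY : integral Y by apply: integral_Zto_horner.
have VY : V * Y = 1 + p%:R * W.
  have := congr1 (fun Q => (Zto algC Q).[theta]) uvw.
  rewrite !rmorphD !rmorphM rmorph1 /= map_polyZ !hornerD !hornerM (eqP ftheta).
  by rewrite mulr0 add0r hornerC hornerZ /= -pmulrn.
have [P P_mon PV] := iV.
(* Homogenizing P(V) = 0 with Y gives zero at the pair (V Y, Y). As V Y is 1 modulo p, the value at
   (1, Y), which is Z(mu), is p times an algebraic integer. *)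
pose Z := homog _ P 1 (D ^+ e *: h).
have Zmu : exists2 w', integral w' & (Zto algC Z).[mu] = w' * p%:R.
  have -> : (Zto algC Z).[mu] = homog _ P 1 Y.
    rewrite homog_horner rmorph1 hornerC map_polyZ hornerZ PsiE.
    by rewrite rmorphXn.
  have hVY : homog _ P (V * Y) Y = 0 by rewrite homog_mul -horner_Zto (eqP PV) mulr0.
  have pow i : exists2 t, integral t & (V * Y) ^+ i = 1 + p%:R * t.
    elim: i => [|i [t it IH]]; first by exists 0; rewrite ?mulr0 ?addr0 //; apply: integral0.
    exists (W + t + p%:R * W * t); last by rewrite exprS IH VY; ring.
    by do !apply: integral_add => //; do !apply: integral_mul => //; apply: integral_nat.
  have [t tE] : exists t : nat -> algC,
      forall i, integral (t i) /\ (V * Y) ^+ i = 1 + p%:R * t i.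
    exists (fun i => xget 0 [set t | integral t /\ (V * Y) ^+ i = 1 + p%:R * t]) => i.
    by apply: (@xgetPex _ 0 [set t | integral t /\ _]); have [t ? ?] := pow i; exists t.
  exists (- \sum_(i < size P) (P`_i)%:~R * t i * Y ^+ ((size P).-1 - i)).
    rewrite -[X in integral X]add0r; apply: integral_sub; first exact: integral0.
    elim/big_ind: _ => [|x y ix iy|i _]; [exact: integral0|exact: integral_add|].
    apply: integral_mul; last exact: integral_exp.
    by apply: integral_mul; [exact: integral_id|have [] := tE i].
  rewrite -[RHS]addr0 -{2}hVY mulNr mulr_suml /homog -sumrN -big_split /=.
  apply: eq_bigr => i _; have [_ ->] := tE i; rewrite expr1n; ring.
have Za : (Zto F1 Z).[a] = 1.
  rewrite homog_horner map_polyZ hornerZ (eqP ha) mulr0 homog_0 //.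
  by rewrite rmorph1 hornerC expr1n.
have [w' [E E_mon Ew'] ZE] := Zmu.
(* [E] is a monic equation of w' = Z(mu) / p. Its homogenization at (Z, p) vanishes at mu, but
   modulo p its value at [a] is a power of Z(a) = 1. *)
have : root (Zto algC (homog _ E Z p%:Z%:P)) mu.
  rewrite /root homog_horner map_polyC hornerC /= ZE -pmulrn homog_mul -horner_Zto.
  by rewrite (eqP Ew') mulr0.
case/gdvd => H /(congr1 (fun Q => (Zto F1 Q).[a])).
rewrite rmorphM hornerM (eqP ga) mul0r homog_horner Za map_polyC hornerC /= -pmulrn.
by rewrite (pcharf0 pF1) homog_0 // expr1n => /eqP; rewrite oner_eq0.
Qed.

(** For N from [minpoly_separable] and p not dividing it, the roots of [f] modulo p are distinct,
    which is what [Frobenius_mod] requires. *)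
Lemma exists_unramified (theta : algC) (f : {poly int}) :
  f \is monic -> root (Zto algC f) theta ->
  (forall G, root (Zto algC G) theta -> exists H, G = f * H) ->
  exists2 N : int, N != 0 & forall p, prime p -> ~~ (p %| N)%Z ->
    exists (F : finFieldType) (rs : seq F),
      [/\ p \in [pchar F], Zto F f %= \prod_(x <- rs) ('X - x%:P), rs != [::] &
        forall x, root (Zto F f) x -> unramified_point theta f p F x].
Proof.
move=> f_mon ftheta fdvd.
have [N [A [H [N0 E]]]] := minpoly_separable _ _ f_mon ftheta fdvd.
exists N => // p p_pr pN.
have fF (K : fieldType) : Zto K f \is monic by apply: monic_map.
have [F [pF [rs frs]]] := exists_splitting_finField _ _ p_pr (monic_neq0 (fF _)).
have NF : N%:~R != 0 :> F by rewrite -(dvdz_pcharf pF).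
have urs : uniq rs.
  rewrite -separable_prod_XsubC -(eqp_separable frs).
  rewrite unlock; apply/Bezout_coprimepP; exists (- Zto F A, Zto F H) => /=.
  have := congr1 (fun Q => Zto F Q) E; rewrite rmorphM rmorphD rmorphM /= map_polyC deriv_map.
  move=> ->; rewrite mulNr [X in _ + (_ + X)]mulrC addrC addrK.
  by rewrite -size_poly_eq1 size_polyC NF.
exists F, rs; split=> //.
- apply: contraTneq (ftheta) => rs0; move: frs; rewrite rs0 big_nil => /eqp_size.
  rewrite size_poly1 size_map_poly_id0; last by rewrite (monicP f_mon) rmorph1 oner_eq0.
  move=> /eqP/size_poly1P[c c0 fE]; have := monicP f_mon; rewrite fE lead_coefC => ->.
  by rewrite rmorph1 /root hornerC oner_eq0.
by move=> x fx; split=> //; apply: Frobenius_mod frs.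
Qed.

Lemma exists_local_unit (theta x : algC) (f : {poly int}) :
  integral theta -> in_Q theta x -> x != 0 ->
  exists2 N : int, N != 0 & forall p (F : finFieldType) (alpha : F),
    unramified_point theta f p F alpha -> ~~ (p %| N)%Z ->
    local_unit theta F alpha x.
Proof.
move=> itheta Qx x0.
have [D [G [D0 DG]]] := Qx; have [E [H [E0 EH]]] := in_QV _ _ itheta Qx.
exists (D * E); first by rewrite mulf_neq0.
move=> p F alpha ramP pDE; apply: (local_unit_of_inverses _ _ _ _ _ ramP _ D E G H) => //.
  by apply: contra pDE; apply: dvdz_mulr.
by apply: contra pDE; apply: dvdz_mull.
Qed.

(** * Prime ideals of the ring of integers *)

Section IdealPowers.
Variables (R : comNzRingType) (P : set R).
Hypothesis idealP : idealr_closed (mem P).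

Let P0 : P 0. Proof. by case: idealP; rewrite inE. Qed.
Let PM (r x : R) : P x -> P (r * x).
Proof.
case: idealP => _ _ PMD Px; rewrite -[r * x]addr0; apply/set_mem; apply: PMD; exact/mem_set.
Qed.

Lemma ideal_expD (i : nat) (x y : R) :
  ideal_exp P i x -> ideal_exp P i y -> ideal_exp P i (x + y).
Proof.
case: i => // i [n [u [v [uv ->]]]] [m [u' [v' [uv' ->]]]].
exists (n + m)%N, (fun k => match split k with inl j => u j | inr j => u' j end),
  (fun k => match split k with inl j => v j | inr j => v' j end); split.
  by move=> k; case: split.
rewrite big_split_ord /=; congr (_ + _); apply: eq_bigr => j _.
  by rewrite (unsplitK (inl j)).
by rewrite (unsplitK (inr j)).
Qed.

Lemma ideal_expM (i : nat) (r x : R) : ideal_exp P i x -> ideal_exp P i (r * x).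
Proof.
case: i => // i [n [u [v [uv ->]]]]; exists n, (fun k => r * u k), v; split.
  by move=> k; have [Pu Pv] := uv k; split=> //; apply: PM.
by rewrite mulr_sumr; apply: eq_bigr => k _; rewrite mulrA.
Qed.

Lemma ideal_exp_mulX (i : nat) (x r : R) : P x -> ideal_exp P i (x ^+ i * r).
Proof.
move=> Px; elim: i => // i IH; exists 1%N, (fun=> x), (fun=> x ^+ i * r).
by split=> //; rewrite big_ord1 exprS mulrA.
Qed.

End IdealPowers.

(** * The valuation attached to the kernel of the residue map *)

Section Valuation.
Variables (K : fieldExtType rat) (iota : {rmorphism K -> algC}).
Variables (theta : algC) (f : {poly int}) (p : nat) (F : finFieldType) (alpha : F).
Hypothesis ramP : unramified_point theta f p F alpha.
Hypothesis iotaQ : forall x, in_Q theta (iota x).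

Let pF : p \in [pchar F]. Proof. by case: ramP. Qed.
Let p_pr : prime p. Proof. exact: pcharf_prime pF. Qed.
Let pC0 : p%:R != 0 :> algC. Proof. by rewrite pnatr_eq0 -lt0n prime_gt0. Qed.
Let pK0 : p%:R != 0 :> K. Proof. by rewrite -(fmorph_eq0 iota) rmorph_nat. Qed.

Let res := residue theta F alpha.
Let loc := local_integer theta F alpha.
Let ord := has_ord theta p F alpha.

Lemma integers_val_int (z : int) : (z%:~R : integers K) = z%:~R :> K.
Proof. exact: (rmorph_int (val : integers K -> K)). Qed.

Lemma integers_val_nat (n : nat) : (n%:R : integers K) = n%:R :> K.
Proof. exact: (rmorph_nat (val : integers K -> K)). Qed.

Lemma integers_valX (y : integers K) (n : nat) : y ^+ n = (y : K) ^+ n :> K.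
Proof. exact: (rmorphXn (val : integers K -> K)). Qed.

Definition residue_ideal : set (integers K) :=
  [set y | res (iota (y : K)) 0].

Lemma integral_iota (x : K) : integral (iota x) <-> integral x.
Proof.
by split=> -[P P_mon Px]; exists P => //; move: Px;
  rewrite -(fmorph_root iota) -map_poly_comp (@eq_map_poly _ _ (iota \o intr) intr) // => z;
  rewrite /= rmorph_int.
Qed.

Lemma integers_local (y : integers K) : loc (iota (y : K)).
Proof.
apply: (integral_local_integer ramP) => //.
by apply/integral_iota; apply/asboolP; apply: integers_valP.
Qed.

Lemma integral_integers (x : K) : integral x -> exists y : integers K, y = x :> K.
Proof. by move/asboolP => ix; exists (Integers ix). Qed.

(* If [A] is a polynomial equation of [x] with integral coefficients, its Horner
   partial sums [s] and the products [s * x] are integral; the first coefficient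
   with nonzero residue provides a partial sum with nonzero residue. *)
Lemma integral_denominator (n : nat) (A : {poly K}) (i : nat) (x : K) :
  (size A <= n.+1)%N -> (forall j, integral A`_j) -> A.[x] = 0 -> loc (iota x) ->
  ~ res (iota A`_i) 0 ->
  exists s, [/\ integral s, integral (s * x) & ~ res (iota s) 0].
Proof.
elim: n A => [|n IH] A sA iA Ax lx resA.
  case: resA; move: Ax; rewrite (size1_polyC sA) hornerC => ->.
  by rewrite coef0 rmorph0; apply: residue0.
have iax := integral_coef_mul_root _ _ _ _ sA iA Ax.
have [a0|a0] := pselect (res (iota A`_n.+1) 0); last by exists A`_n.+1.
(* With a the top coefficient, trade a X^(n+1) for (a x) X^n: the value at x is unchanged, and since
   a has residue 0 so are the residues of the other coefficients. *)
pose B := A - A`_n.+1 *: 'X^(n.+1) + (A`_n.+1 * x) *: 'X^n.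
have BE j : B`_j = (if (j == n.+1)%N then 0 else A`_j) +
    (if (j == n)%N then A`_n.+1 * x else 0).
  rewrite coefD coefB !coefZ !coefXn; congr (_ + _).
    by case: eqP => [->|_]; rewrite ?mulr1 ?subrr // mulr0 subr0.
  by case: eqP; rewrite ?mulr1 ?mulr0.
apply: (IH B) => //.
- apply/leq_sizeP => j nj; rewrite BE [X in _ + X]ifN ?addr0; last first.
    by rewrite gtn_eqF.
  case: eqP => // /eqP jn; rewrite nth_default //; apply: leq_trans sA _.
  by rewrite ltn_neqAle eq_sym jn.
- move=> j; rewrite BE; apply: integral_add.
    by case: eqP => // _; apply: integral0.
  by case: eqP => // _; apply: integral0.
- rewrite !hornerE Ax /= exprS; ring.
move=> resB; apply: resA; move: resB; rewrite BE.
case: eqP => [-> //|_]; case: eqP => [->|_]; last by rewrite addr0.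
rewrite rmorphD rmorphM /= => resB; have [c xc] := lx.
have := residueB resB (residueM a0 xc).
by rewrite addrK mul0r subr0.
Qed.

(** A primitive equation of x has a coefficient prime to p, hence of nonzero residue, and
    [integral_denominator] applies. *)
Lemma local_fraction (x : K) : loc (iota x) -> exists s t : integers K,
  [/\ ~ residue_ideal s & (s : K) * x = (t : K)].
Proof.
move=> lx; have [g [g0 gx _]] := exists_primitive_minpoly (iota x).
have Agx : (Zto K g).[x] = 0.
  apply/eqP; rewrite -/(root _ _) -(fmorph_root iota) -map_poly_comp.
  by rewrite (@eq_map_poly _ _ (iota \o intr) intr) // => z; rewrite /= rmorph_int.
have [i gi] : exists i, ~~ (p %| g`_i)%Z.
  apply: contrapT => nog; have /eqP := g0 p p_pr; apply.
  apply/polyP => i; rewrite coef_map coef0; apply/eqP.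
  rewrite -(dvdz_pcharf (pchar_Fp p_pr)); apply: contrapT => /negP gi.
  by apply: nog; exists i.
have [|||s [/integral_integers[s' <-] /integral_integers[t tE] ns]] :=
  integral_denominator (size g) (Zto K g) i x _ _ Agx lx.
- by apply: leq_trans (size_poly _ _) _; apply: leqW.
- by move=> j; rewrite coef_map; apply: integral_id.
- rewrite coef_map /= rmorph_int => r0.
  move: gi; rewrite (dvdz_pcharf pF) => /eqP; apply.
  exact: (residue_uniq ramP (residue_int _) r0).
by exists s', t.
Qed.

Lemma residue_ideal_closed : idealr_closed (mem residue_ideal).
Proof.
split.
- by apply/mem_set; rewrite /residue_ideal /= rmorph0; apply: residue0.
- apply/negP => /set_mem; rewrite /residue_ideal /= rmorph1 => r0.
  by have /eqP := residue_uniq ramP residue1 r0; rewrite oner_eq0.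
move=> a u v /set_mem u0 /set_mem v0; apply/mem_set.
rewrite /residue_ideal /= rmorphD rmorphM /=; have [c ac] := integers_local a.
have -> : 0 = c * 0 + 0 :> F by rewrite mulr0 addr0.
by apply: residueD => //; apply: residueM.
Qed.

Lemma residue_ideal_prime : prime_idealr_closed (mem residue_ideal).
Proof.
move=> u v /set_mem; rewrite /residue_ideal /= rmorphM /= => uv0.
have [b ub] := integers_local u; have [c vc] := integers_local v.
have := residue_uniq ramP uv0 (residueM ub vc).
move=> /esym/eqP; rewrite mulf_eq0 => /orP[/eqP b0|/eqP c0]; apply/orP.
  by left; apply/mem_set; rewrite /residue_ideal /= -b0.
by right; apply/mem_set; rewrite /residue_ideal /= -c0.
Qed.

Lemma residue_ideal_p : residue_ideal p%:R.
Proof.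
rewrite /residue_ideal /= integers_val_nat rmorph_nat -(pcharf0 pF); exact: residue_nat.
Qed.

Lemma residue_ideal_nonzero_prime : nonzero_prime_ideal residue_ideal.
Proof.
split; [exact: residue_ideal_closed|exact: residue_ideal_prime|].
exists p%:R; first by rewrite inE; apply: residue_ideal_p.
by apply: contra_neq pK0 => /(congr1 (fun y : integers K => (y : K))); rewrite integers_val_nat.
Qed.

(** For the converse write x = t / s with s outside the ideal. Then s y = p^i t lies in the i-th
    power, and s is invertible modulo that power. *)
Lemma ideal_exp_residue (i : nat) (y : integers K) :
  ideal_exp residue_ideal i y <-> exists2 x, loc x & iota (y : K) = p%:R ^+ i * x.
Proof.
split.
  elim: i y => [|i IH] y; first by exists (iota (y : K)); rewrite ?mul1r //; apply: integers_local.
  move=> [n [u [v [uv ->]]]]; elim/big_ind: _ => [|a b [x [c xc] ax] [x' [c' xc'] bx]|k _].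
  - by exists 0; rewrite ?mulr0 ?rmorph0 //; exists 0; apply: residue0.
  - exists (x + x'); first by exists (c + c'); apply: residueD.
    by rewrite !rmorphD /= ax bx mulrDr.
  have [/(residue0_divp ramP)[x [c xc] ux] /IH[x' [c' xc'] vx]] := uv k.
  exists (x * x'); first by exists (c * c'); apply: residueM.
  by rewrite !rmorphM /= ux vx exprS; ring.
move=> [x lx yE].
have xE : x = iota ((y : K) / p%:R ^+ i).
  by rewrite fmorph_div rmorphXn rmorph_nat /= yE mulrC mulKf // expf_neq0.
rewrite xE in lx; have [s [t [ns st]]] := local_fraction _ lx.
have {}st : s * y = p%:R ^+ i * t.
  apply: val_inj; rewrite /= integers_valX integers_val_nat -st.
  by rewrite mulrCA [X in _ = _ * X]mulrC divfK // expf_neq0.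
have idP := residue_ideal_closed.
have [b sb] := integers_local s.
have b0 : b != 0 by apply/eqP => b0; apply: ns; rewrite /residue_ideal /= -b0.
have F1 := finNzRing_gt1 F.
pose e := 1 - s ^+ #|F|.-1.
have Pe : residue_ideal e.
  rewrite /residue_ideal /= integers_valX rmorphB rmorph1 rmorphXn /=.
  have -> : 0 = 1 - b ^+ #|F|.-1 :> F.
    have -> : b ^+ #|F|.-1 = 1; last by rewrite subrr.
    by apply: (mulfI b0); rewrite -exprS prednK ?expf_card ?mulr1 // ltnW.
  by apply: residueB; [exact: residue1|exact: residueX].
(* Since e lies in the ideal, e^i y lies in its i-th power. The rest, (1 - e^i) y, is a multiple of
   s y because 1 - e is a positive power of s. *)
have -> : y = e ^+ i * y + (\sum_(k < i) e ^+ k * s ^+ #|F|.-2) * (s * y).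
  rewrite -mulr_suml -mulrA [_ * (s * y)]mulrA -exprSr prednK -?subn1 ?subn_gt0 // subn1.
  have /eqP := subrX1 e i; rewrite subr_eq => /eqP {1}->.
  have -> : e - 1 = - s ^+ #|F|.-1 by rewrite /e addrAC subrr sub0r.
  by ring.
apply: ideal_expD; first exact: ideal_exp_mulX.
by apply: ideal_expM => //; rewrite st; apply: ideal_exp_mulX; apply: residue_ideal_p.
Qed.

Lemma ideal_ordP (y : integers K) (i : nat) :
  ideal_ord residue_ideal y i <-> ord (iota (y : K)) i.
Proof.
split=> [[/ideal_exp_residue[x [b xb] yE] nP]|[u [b ub b0] yE]].
  exists x => //; exists b => //; apply/eqP => b0; apply: nP; apply/ideal_exp_residue.
  rewrite b0 in xb; have [z lz xE] := residue0_divp ramP xb.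
  by exists z => //; rewrite yE xE exprSr mulrA.
split; first by apply/ideal_exp_residue; exists u => //; exists b.
move=> /ideal_exp_residue[x lx]; rewrite yE exprSr -mulrA -exprnP => E.
move: b0; have -> : b = 0; last by rewrite eqxx.
apply: (residue_uniq ramP ub).
rewrite (mulfI (expf_neq0 _ pC0) E); exact: (residue_mulp ramP).
Qed.

Lemma ord_integers (y : integers K) : y != 0 :> K -> exists i : nat, ord (iota (y : K)) i.
Proof.
move=> y0; have yC0 : iota (y : K) != 0 by rewrite fmorph_eq0.
have [[n|n] yn] := has_ord_exists ramP (iotaQ (y : K)) yC0; first by exists n.
exfalso; have := has_ordV ramP yn; rewrite NegzE opprK.
move=> /(has_ord_gt0 ramP) r0; have [b yb] := integers_local y.
have := residueM yb r0; rewrite mulr0 mulfV // => r1.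
by have /eqP := residue_uniq ramP residue1 r1; rewrite oner_eq0.
Qed.

(** The set under [xget] is the singleton of k: orders of fractions are unique, and x = (D x) / D
    with an integer D clearing denominators is a fraction of the required kind. *)
Lemma valuation_residue_ideal (x : K) (k : int) :
  ord (iota x) k -> valuation residue_ideal x = k%:E.
Proof.
move=> xk; have := has_ord_neq0 ramP xk; rewrite fmorph_eq0 /valuation => x0.
rewrite (negPf x0); congr (_%:E).
have fracE (y z : integers K) (i j : nat) : x = (y : K) / (z : K) ->
    ord (iota (y : K)) i -> ord (iota (z : K)) j -> i%:Z - j%:Z = k.
  move=> xyz yi zj; apply: (has_ord_uniq ramP _ xk).
  by rewrite xyz fmorph_div; exact: (has_ordM ramP yi (has_ordV ramP zj)).
apply: xget_unique => [|k' [y [z [i [j [z0 xyz /ideal_ordP yi /ideal_ordP zj ->]]]]]]; last first.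
  exact: fracE xyz yi zj.
have [D D0 iDx] := exists_integral_multiple (iota x).
have [y yE] : exists y : integers K, (y : K) = D%:~R * x.
  by apply: integral_integers; apply/integral_iota; rewrite rmorphM rmorph_int.
have DK : (D%:~R : K) != 0 by rewrite -(fmorph_eq0 iota) rmorph_int intr_eq0.
pose d : integers K := D%:~R; have dE : (d : K) = D%:~R := integers_val_int D.
have xyd : x = (y : K) / (d : K) by rewrite dE yE mulrC mulKf.
have [i yi] : exists i : nat, ord (iota (y : K)) i.
  by apply: ord_integers; rewrite yE mulf_neq0.
have [j dj] : exists j : nat, ord (iota (d : K)) j by apply: ord_integers; rewrite dE.
exists y, d, i, j; split=> //; [|exact/ideal_ordP|exact/ideal_ordP|].
  by apply: contra_neq DK => d0; rewrite -dE d0.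
by rewrite (fracE _ _ _ _ xyd yi dj).
Qed.

End Valuation.

(** * Recurrences of order two *)

Lemma poly_eq0_int (P : {poly algC}) : (forall n : int, P.[n%:~R] = 0) -> P = 0.
Proof.
move=> Pn; apply/eqP; apply: contraT => P0.
have := @max_poly_roots _ P [seq n%:R | n <- iota 0 (size P)] P0.
rewrite size_map size_iota ltnn; apply.
  by apply/allP => _ /mapP[n _ ->]; rewrite /root -[n%:R]/((n%:Z)%:~R) Pn.
rewrite map_inj_uniq ?iota_uniq // => m n /eqP.
by rewrite eqr_nat => /eqP.
Qed.

Lemma size_shift_sub (Q : {poly algC}) :
  Q != 0 -> (size (Q \Po ('X + 1%:P) - Q)%R < size Q)%N.
Proof.
move=> Q0; have sX : size ('X + 1%:P : {poly algC}) = 2%N by rewrite size_XaddC.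
have sQ : size (Q \Po ('X + 1%:P)) = size Q by rewrite size_comp_poly2.
rewrite [X in (_ < X)%N]polySpred // ltnS; apply/leq_sizeP => j.
rewrite leq_eqVlt coefB => /orP[/eqP<-|jQ].
  rewrite -{1}sQ -!/(lead_coef _) lead_coef_comp ?sX //.
  by rewrite lead_coefXaddC expr1n mulr1 subrr.
by rewrite !nth_default ?subrr // ?sQ -(prednK (n := size Q)) ?size_poly_gt0.
Qed.

(** Shifting n by one and subtracting y times the original relation lowers the degree of Q, while
    the leading coefficient of P is only multiplied by x - y. *)
Lemma exponential_polynomials_free (x y : algC) (P Q : {poly algC}) :
  x != 0 -> y != 0 -> x != y ->
  (forall n : int, P.[n%:~R] * x ^ n + Q.[n%:~R] * y ^ n = 0) -> P = 0 /\ Q = 0.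
Proof.
move=> x0 y0 xy; have [m] := ubnP (size Q); elim: m P Q => // m IH P Q.
rewrite ltnS => Qm PQ; have [Q0|Q0] := eqVneq Q 0.
  split=> //; apply: poly_eq0_int => n; have := PQ n.
  rewrite Q0 horner0 mul0r addr0 => /eqP.
  by rewrite mulf_eq0 expfz_eq0 (negPf x0) andbF orbF => /eqP.
pose P1 := x *: (P \Po ('X + 1%:P)) - y *: P.
pose Q1 := y *: (Q \Po ('X + 1%:P) - Q).
have P0 : P = 0.
  have [||P10 _] := IH P1 Q1.
  - apply: leq_trans Qm; apply: leq_ltn_trans (size_scale_leq _ _) _.
    exact: size_shift_sub.
  - move=> n; have := PQ (n + 1); rewrite !expfzDr // rmorphD /= => PQn1.
    rewrite !(hornerZ, hornerD, hornerN, horner_comp, hornerX, hornerC).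
    rewrite [LHS](_ : _ =
      P.[n%:~R + 1] * (x ^ n * x ^ 1) + Q.[n%:~R + 1] * (y ^ n * y ^ 1) -
      y * (P.[n%:~R] * x ^ n + Q.[n%:~R] * y ^ n)); last by rewrite !expr1z; ring.
    by rewrite PQn1 PQ mulr0 subr0.
  apply/eqP; apply: contraT => P0; have := congr1 (fun R : {poly algC} => R`_(size P).-1) P10.
  have sP : size (P \Po ('X + 1%:P)) = size P by rewrite size_comp_poly2 ?size_XaddC.
  rewrite coefB !coefZ coef0 -{1}sP -!/(lead_coef _) lead_coef_comp ?size_XaddC //.
  rewrite lead_coefXaddC expr1n mulr1 -mulrBl => /eqP.
  by rewrite mulf_eq0 subr_eq0 (negPf xy) lead_coef_eq0 (negPf P0).
split=> //; apply: poly_eq0_int => n; have := PQ n.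
rewrite P0 horner0 mul0r add0r => /eqP.
by rewrite mulf_eq0 expfz_eq0 (negPf y0) andbF orbF => /eqP.
Qed.

Lemma recurrence2_eq0 (x y : algC) (W : int -> algC) : x * y != 0 ->
  (forall n, W (n + 2) = (x + y) * W (n + 1) - x * y * W n) ->
  W 0 = 0 -> W 1 = 0 -> forall n, W n = 0.
Proof.
move=> xy0 WE W0 W1.
have pos (n : nat) : W n = 0 /\ W n.+1 = 0.
  elim: n => [|n [IH IH1]]; first by [].
  split=> //; have := WE n; rewrite -!PoszD addn2 addn1 IH IH1 => ->.
  by rewrite !mulr0 subrr.
have neg (n : nat) : W (- n%:Z) = 0 /\ W (- n%:Z + 1) = 0.
  elim: n => [|n [IH IH1]]; first by rewrite oppr0 add0r.
  have e1 : - (n.+1)%:Z + 1 = - n%:Z by lia.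
  have e2 : - (n.+1)%:Z + 2 = - n%:Z + 1 by lia.
  split; last by rewrite e1.
  have := WE (- n.+1%:Z); rewrite e1 e2 IH IH1 mulr0 sub0r => /esym/eqP.
  by rewrite oppr_eq0 mulf_eq0 (negPf xy0) => /eqP.
by case=> n; [have [] := pos n|rewrite NegzE; have [] := neg n.+1].
Qed.

Lemma recurrence2_simple (x y : algC) (V : int -> algC) : x * y != 0 -> x != y ->
  (forall n, V (n + 2) = (x + y) * V (n + 1) - x * y * V n) ->
  exists c d, forall n, V n = c * x ^ n + d * y ^ n.
Proof.
move=> xy0 xy VE; have := xy0; rewrite mulf_eq0 negb_or => /andP[x0 y0].
have xy' : x - y != 0 by rewrite subr_eq0.
exists ((V 1 - y * V 0) / (x - y)), ((x * V 0 - V 1) / (x - y)).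
set c := _ / _; set d := _ / _ => n; apply/eqP; rewrite -subr_eq0; apply/eqP.
apply: (recurrence2_eq0 x y (fun n => V n - (c * x ^ n + d * y ^ n)) xy0).
- by move=> {}n; rewrite VE !expfzDr // !expr1z; ring.
- by rewrite !expr0z /c /d; field.
- by rewrite !expr1z /c /d; field.
Qed.

Lemma recurrence2_double (x : algC) (V : int -> algC) : x != 0 ->
  (forall n, V (n + 2) = (x + x) * V (n + 1) - x * x * V n) ->
  exists c d, forall n, V n = (c * n%:~R + d) * x ^ n.
Proof.
move=> x0 VE; exists (V 1 / x - V 0), (V 0).
set c := _ - _ => n; apply/eqP; rewrite -subr_eq0; apply/eqP.
apply: (recurrence2_eq0 x x (fun n => V n - (c * n%:~R + V 0) * x ^ n)).
- by rewrite mulf_neq0.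
- by move=> {}n; rewrite VE !expfzDr // !expr1z !rmorphD /=; ring.
- by rewrite expr0z; ring.
- by rewrite expr1z /c; field.
Qed.

Section Order2.
Variables (K : fieldExtType rat) (iota : {rmorphism K -> algC}) (U : int -> K).
Hypothesis U2 : lrs_of_order 2 U.

Lemma recurrence2P (a : 'I_2 -> K) (n : int) : recurrence a U ->
  U (n + 2) = a ord0 * U n + a ord_max * U (n + 1).
Proof.
case=> _ /(_ n); rewrite !big_ord_recl big_ord0 addr0 /= addr0 => ->.
by congr (_ * _ + a _ * _); apply: val_inj.
Qed.

Lemma minimal_order_gt1 (m : nat) (a : 'I_m -> K) : recurrence a U -> (1 < m)%N.
Proof. by case: U2 => a' [_ min_a']; apply: min_a'. Qed.

Lemma order2_not_geometric (x : K) : ~ (forall n : int, U (n + 1) = x * U n).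
Proof.
(* For x = 0 the order drops to 0 rather than 1, since [recurrence] demands a nonzero constant
   coefficient. *)
move=> Ux; have [x0|x0] := eqVneq x 0.
  suff : recurrence (fun _ : 'I_0 => 0) U by move/minimal_order_gt1.
  split=> [[]//|n]; rewrite big_ord0 addr0 -[n](subrK 1) Ux x0 mul0r //.
suff : recurrence (fun _ : 'I_1 => x) U by move/minimal_order_gt1.
by split=> // n; rewrite big_ord1 /= addr0 Ux.
Qed.

(** The difference of two distinct recurrences would make U geometric or zero. *)
Lemma order2_coef_uniq (a b : 'I_2 -> K) : recurrence a U -> recurrence b U ->
  a ord0 = b ord0 /\ a ord_max = b ord_max.
Proof.
move=> ra rb.
have E n : (b ord_max - a ord_max) * U (n + 1) = (a ord0 - b ord0) * U n.
  apply/eqP; rewrite -subr_eq0 -(subrr (U (n + 2))) {1}(recurrence2P b n rb).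
  by rewrite (recurrence2P a n ra); apply/eqP; ring.
have [max_eq|max_neq] := eqVneq (a ord_max) (b ord_max).
  split=> //; apply/eqP; rewrite -subr_eq0; apply: contraT => c0.
  case: (order2_not_geometric 0) => n; rewrite mul0r.
  by have := E (n + 1); rewrite max_eq subrr mul0r => /esym/eqP; rewrite mulf_eq0 (negPf c0) => /eqP.
case: (order2_not_geometric ((a ord0 - b ord0) / (b ord_max - a ord_max))) => n.
have m0 : b ord_max - a ord_max != 0 by rewrite subr_eq0 eq_sym.
by apply: (mulfI m0); rewrite E mulrA mulrCA mulfV // mulr1.
Qed.

(** [char_root] ranges over all minimal recurrences; by [order2_coef_uniq] they share one
    characteristic polynomial, whose roots with multiplicity are x and y. *)
Lemma order2_char_root : exists x y : algC, [/\ x * y != 0,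
  forall z, char_root iota U z <-> z = x \/ z = y &
  forall n, iota (U (n + 2)) = (x + y) * iota (U (n + 1)) - x * y * iota (U n)].
Proof.
have [a [ra min_a]] := U2.
set b0 := iota (a ord0); set b1 := iota (a ord_max).
pose s := sqrtC (b1 ^+ 2 + 4 * b0); have sE : s ^+ 2 = b1 ^+ 2 + 4 * b0 by apply: sqrtCK.
pose x := (b1 + s) / 2; pose y := (b1 - s) / 2.
have xDy : x + y = b1 by rewrite /x /y; field.
have xMy : x * y = - b0.
  have -> : x * y = (b1 ^+ 2 - s ^+ 2) / 4 by rewrite /x /y; field.
  by rewrite sE; field.
have rootE (a' : 'I_2 -> K) z : recurrence a' U ->
    root (map_poly iota (char_poly_rec a')) z = (z == x) || (z == y).
  move=> /(order2_coef_uniq a a' ra)[a0 a1].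
  have -> : (root (map_poly iota (char_poly_rec a')) z) = ((z - x) * (z - y) == 0).
    rewrite /char_poly_rec rmorphB rmorph_sum /= map_polyXn.
    rewrite !big_ord_recl big_ord0 addr0 !map_polyZ /= !map_polyXn /root.
    have -> : lift ord0 ord0 = ord_max :> 'I_2 by apply: val_inj.
    rewrite -a0 -a1 -/b0 -/b1 -xDy -[b0]opprK -xMy /=; congr (_ == _).
    by rewrite hornerD hornerN hornerD !hornerZ !hornerXn /= expr0 expr1; ring.
  by rewrite mulf_eq0 !subr_eq0.
exists x, y; split.
- by rewrite xMy oppr_eq0 fmorph_eq0; case: ra => /(_ ord0)->.
- move=> z; split=> [[m [a' [[ra' min_a'] za']]]|zxy].
    have m2 : m = 2 by apply/eqP; rewrite eqn_leq (min_a' _ _ ra) (min_a _ _ ra').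
    subst m; move: za'; rewrite rootE // => /orP[/eqP|/eqP]; tauto.
  exists 2, a; split; first by [].
  by rewrite rootE //; case: zxy => ->; rewrite eqxx ?orbT.
move=> n; rewrite (recurrence2P a) // rmorphD !rmorphM /= xDy xMy -/b0 -/b1; ring.
Qed.

Lemma root_of_unity_neq0 (z : algC) : Defs.root_of_unity z -> z != 0.
Proof.
move=> [k k0 /unity_rootP zk]; apply: contra_eq_neq zk => ->.
by rewrite expr0n gtn_eqF // eq_sym oner_neq0.
Qed.

(** For a double root the single coefficient polynomial is linear and the twisted relation says that
    it vanishes at a. For distinct roots both coefficients are constants, and the relation expresses
    c x^a as a root of unity times d y^a. *)
Lemma twisted_zero_order2 (a : int) : non_degenerate iota U -> twisted_zero iota U a ->
  (exists c x : algC, [/\ c != 0, x != 0 &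
     forall n, iota (U n) = c * (n - a)%:~R * x ^ n]) \/
  (exists (c x mu xi : algC) (r : nat),
     [/\ [/\ c != 0, x != 0 & mu != 0], forall n, (0 < n)%N -> mu ^+ n != 1,
         (0 < r)%N, xi ^+ r = 1 &
     forall n, iota (U n) = c * x ^ n * (1 - xi * mu ^ (n - a))]).
Proof.
move=> [_ nondeg] [s [f [lam [xi [[lam_inj lamP f0 UE] xiU tw]]]]].
have [x [y [xy0 rootP VE]]] := order2_char_root.
have := xy0; rewrite mulf_eq0 negb_or => /andP[x0 y0].
have lam_xy i : lam i = x \/ lam i = y by apply/rootP/lamP; exists i.
have [ix xE] : exists i, x = lam i by apply/lamP/rootP; left.
have [iy yE] : exists i, y = lam i by apply/lamP/rootP; right.
have [xy|xy] := eqVneq x y.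
  left; rewrite -xy in VE lam_xy.
  (* The number [s] of summands is not given in advance; injectivity of [lam] leaves only the index
     of [x]. *)
  have sum1 (G : 'I_s -> algC) : \sum_(i < s) G i = G ix.
    rewrite (bigD1 ix) //= big1 ?addr0 // => i /eqP ii; case: ii; apply: lam_inj.
    by rewrite -xE; have [] := lam_xy i.
  have [c [d VcD]] := recurrence2_double x (fun n => iota (U n)) x0 VE.
  have fE : f ix = c *: 'X + d%:P.
    apply/eqP; rewrite -subr_eq0; apply/eqP; apply: poly_eq0_int => n.
    rewrite hornerD hornerN hornerD hornerZ hornerX hornerC.
    apply: (mulIf (expfz_neq0 n x0)); rewrite mul0r mulrBl -VcD UE sum1 -xE.
    by rewrite subrr.
  have d_ca : d = - (c * a%:~R).
    move: tw; rewrite sum1 => /eqP; rewrite !mulf_eq0 expfz_eq0 -xE (negPf x0) andbF orbF.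
    rewrite (negPf (root_of_unity_neq0 _ (xiU ix))) fE hornerD hornerZ hornerX hornerC /=.
    by rewrite addrC addr_eq0 => /eqP.
  exists c, x; split=> //.
    apply: contra_neq (f0 ix) => c0.
    by rewrite fE d_ca c0 mul0r oppr0 scale0r addr0.
  by move=> n; rewrite VcD d_ca rmorphB /=; ring.
right.
have ixy : iy != ix by apply: contra_neq xy => iE; rewrite xE yE iE.
have sum2 (G : 'I_s -> algC) : \sum_(i < s) G i = G ix + G iy.
  rewrite (bigD1 ix) //= (bigD1 iy) //= big1 ?addr0 // => i /andP[/eqP iix /eqP iiy].
  by case: (lam_xy i) => E; [case: iix|case: iiy]; apply: lam_inj; rewrite E.
have [c [d VcD]] := recurrence2_simple x y (fun n => iota (U n)) xy0 xy VE.
have [|fx fy] := exponential_polynomials_free x y (f ix - c%:P) (f iy - d%:P) x0 y0 xy.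
  move=> n; rewrite !hornerD !hornerN !hornerC.
  have := UE n; rewrite VcD sum2 -xE -yE => E.
  by rewrite -[RHS](subrr (c * x ^ n + d * y ^ n)) {1}E; ring.
have {}fx : f ix = c%:P by apply/eqP; rewrite -subr_eq0 fx.
have {}fy : f iy = d%:P by apply/eqP; rewrite -subr_eq0 fy.
have c0 : c != 0 by have := f0 ix; rewrite fx polyC_eq0.
have d0 : d != 0 by have := f0 iy; rewrite fy polyC_eq0.
have xix0 := root_of_unity_neq0 _ (xiU ix); have xiy0 := root_of_unity_neq0 _ (xiU iy).
have [k k0 /unity_rootP xik] := xiU ix; have [l l0 /unity_rootP xil] := xiU iy.
move: tw; rewrite sum2 fx fy !hornerC -xE -yE => tw.
(* Substituting c x^a = - (xi_y / xi_x) d y^a into c x^n + d y^n leaves d y^n as a common factor. *)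
exists d, y, (x / y), (xi iy / xi ix), (k * l)%N; split.
- by rewrite mulf_neq0 ?invr_neq0.
- move=> n n0; apply/eqP => xyn; apply: (nondeg x y) xy _.
  + by apply/rootP; left.
  + by apply/rootP; right.
  by exists n => //; apply/unity_rootP.
- by rewrite muln_gt0 k0.
- by rewrite exprMn exprVn [(k * l)%N]mulnC [X in X / _]exprM xil mulnC exprM xik !expr1n divr1.
move=> n; rewrite VcD.
have cE : c * x ^ a = - (xi iy / xi ix * d * y ^ a).
  apply: (mulfI xix0); rewrite mulrA -[LHS](addrK (xi iy * d * y ^ a)) tw sub0r.
  by field.
have xnE : x ^ n = x ^ a * x ^ (n - a) by rewrite -expfzDr // addrC subrK.
have ynE : y ^ n = y ^ a * y ^ (n - a) by rewrite -expfzDr // addrC subrK.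
have muE : (x / y) ^ (n - a) = x ^ (n - a) / y ^ (n - a).
  by rewrite expfzMl exprz_inv invr_expz.
rewrite xnE mulrA cE muE ynE.
have ya0 := expfz_neq0 a y0; have yn0 := expfz_neq0 (n - a) y0.
by field; rewrite xix0 yn0.
Qed.

End Order2.

(** * Infinitely many primes *)

(** Characteristic roots and roots of unity need not lie in K, so the local analysis takes place in
    Q(theta); the primes of K are contracted from there, with p a uniformizer in both fields. *)
Lemma exists_field_generator (K : fieldExtType rat) (iota : {rmorphism K -> algC})
    (s : seq algC) : exists theta, [/\ integral theta,
  forall x, in_Q theta (iota x) & forall x, x \in s -> in_Q theta x].
Proof.
have [theta [itheta thetaP]] := exists_primitive_element
  ([seq iota b | b <- vbasis {:K}] ++ s).
exists theta; split=> // x => [|xs]; last by apply: thetaP; rewrite mem_cat xs orbT.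
rewrite (coord_vbasis (memvf x)) rmorph_sum.
elim/big_ind: _ => [|y z|i _]; [|exact: in_QD|].
  by rewrite -(rmorph0 (ratr : rat -> algC)); apply: in_Q_ratr.
rewrite rmorphZ_num; apply: in_QM; first exact: in_Q_ratr.
apply: thetaP; rewrite mem_cat; apply/orP; left; apply: map_f.
by rewrite mem_nth // size_tuple.
Qed.

Lemma prime_ideal_inj (K : fieldExtType rat) (P : set (integers K)) (p q : nat) :
  nonzero_prime_ideal P -> prime p -> prime q ->
  p%:R \in P -> q%:R \in P -> p = q.
Proof.
move=> [[P0 nP1 PMD] _ _] p_pr q_pr pP qP; apply/eqP; apply: contraT => pq.
have : coprimez p q by rewrite coprimezE /= prime_coprime // dvdn_prime2.
case/coprimezP => -[u v] /= uv1; case/negP: nP1.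
have -> : 1 = u%:~R * p%:R + (v%:~R * q%:R + 0) :> integers K.
  by rewrite addr0 !pmulrn -!rmorphM -rmorphD /= uv1.
by rewrite (PMD _ _ _ pP) // (PMD _ _ _ qP).
Qed.

(** A prime ideal contains only one rational prime, so finitely many prime ideals contain only
    boundedly large ones. *)
Lemma infinite_prime_ideals (K : fieldExtType rat) (A : set (set (integers K))) :
  (forall P, A P -> nonzero_prime_ideal P) ->
  (forall B : nat, exists p P, [/\ prime p, (B < p)%N, A P & p%:R \in P]) ->
  infinite_set A.
Proof.
move=> A_prime A_large A_fin.
pose g (P : set (integers K)) := xget 0%N [set p : nat | prime p /\ p%:R \in P].
have [s sE] := (finite_seqP _).1 (finite_image g A_fin).
have [p [P [p_pr Bp AP pP]]] := A_large (\max_(i <- s) i)%N.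
have gP : g P = p.
  apply: xget_unique => [|q [q_pr qP]]; first by split.
  exact: prime_ideal_inj (A_prime _ AP) q_pr p_pr qP pP.
have : p \in s.
  suff : [set` s] p by [].
  by rewrite -sE; exists P.
by move=> ps; move: Bp; rewrite ltnNge leq_bigmax_seq.
Qed.

Lemma dvdz_gt (p : nat) (N : int) : N != 0 -> (`|N| < p)%N -> ~~ (p %| N)%Z.
Proof. by move=> N0 Np; rewrite dvdzE /= gtnNdvd // lt0n absz_eq0. Qed.

Lemma padic_valuation_large (p Q : nat) (a a' : int) (N : nat) :
  prime p -> (0 < Q)%N -> ~~ (p %| Q)%N ->
  exists n : int, [/\ (n = a' %[mod Q%:Z])%Z, n != a
    & (N%:Z%:E <= padic_valuation p (n - a))%E].
Proof.
move=> p_pr Q0 pQ.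
have : coprimez (p ^ N)%N Q by rewrite coprimezE /= coprimeXl // prime_coprime.
case/coprimezP => -[u v] /= uv1.
have [j j0 jE] : exists2 j : int, j != 0 & ((p ^ N)%N%:Z * j = a' - a %[mod Q%:Z])%Z.
  have uE : (a' - a = (p ^ N)%N%:Z * (u * (a' - a)) + (v * (a' - a)) * Q%:Z)%R.
    by rewrite -[LHS]mul1r -uv1; ring.
  (* The Bezout solution may be 0, which would give n = a; then Q, in the same class, replaces
     it. *)
  have [u0|u0] := eqVneq (u * (a' - a)) 0; last first.
    by exists (u * (a' - a)) => //; rewrite [X in _ = (X %% _)%Z]uE [X in _ = (X %% _)%Z]addrC modzMDl.
  exists Q%:Z; first by rewrite gt_eqF // ltz_nat.
  by rewrite modzMl [X in _ = (X %% _)%Z]uE u0 mulr0 add0r modzMl.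
exists (a + (p ^ N)%N%:Z * j).
have pj0 : (p ^ N)%N%:Z * j != 0.
  by rewrite mulf_neq0 // gt_eqF // ltz_nat expn_gt0 prime_gt0.
split.
- by rewrite -modzDmr jE modzDmr addrC subrK.
- by rewrite -subr_eq0 addrAC subrr add0r.
rewrite addrAC subrr add0r /padic_valuation (negPf pj0) lee_fin lez_nat.
by rewrite -pfactor_dvdn ?absz_gt0 // abszM dvdn_mulr.
Qed.

(** * Orders of integers, powers and roots of unity at an unramified prime *)

Section PrimeIdeal.
Variables (theta : algC) (f : {poly int}) (p : nat) (F : finFieldType) (alpha : F).
Hypothesis ramP : unramified_point theta f p F alpha.

Let pF : p \in [pchar F]. Proof. by case: ramP. Qed.
Let p_pr : prime p. Proof. exact: pcharf_prime pF. Qed.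
Let ord := has_ord theta p F alpha.

Lemma has_ordN (x : algC) (k : int) : ord x k -> ord (- x) k.
Proof.
move=> [u uu ->]; exists (- u); last by rewrite mulrN.
by have [b ub b0] := uu; exists (- b); [apply: residueN|rewrite oppr_eq0].
Qed.

Lemma has_ord_int (z : int) : z != 0 -> ord z%:~R (logn p `|z|%N).
Proof.
have ord_nat (n : nat) : (0 < n)%N -> ord n%:R (logn p n).
  move=> n0; have [m pm nE] := pfactor_coprime p_pr n0.
  have pm' : ~~ (p %| m%:Z)%Z by rewrite dvdzE /= -prime_coprime.
  exists (m%:Z%:~R); first exact: (local_unit_int ramP).
  by rewrite {1}nE natrM natrX -pmulrn mulrC.
case: z => n n0; first by apply: ord_nat; rewrite lt0n.
by rewrite NegzE rmorphN abszN; apply: has_ordN; apply: ord_nat.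
Qed.

Lemma has_ord_exprz_sub1 (z : algC) (k m : int) : (2 < p)%N -> m != 0 ->
  residue theta F alpha z 1 -> ord (z - 1) k -> ord (z ^ m - 1) (k + logn p `|m|%N).
Proof.
move=> p2; case: m => n m0 z1 zk.
  by apply: (has_ord_expr_sub1 ramP) => //; rewrite lt0n.
have := has_ord_expr_sub1 ramP p2 (ltn0Sn n) z1 zk; rewrite NegzE abszN /=.
have uz : local_unit theta F alpha z by exists 1; rewrite ?oner_neq0.
have zn0 : z ^+ n.+1 != 0 by rewrite expf_neq0 // (local_unit_neq0 ramP).
have -> : z ^ (- n.+1%:Z) - 1 = - ((z ^+ n.+1)^-1 * (z ^+ n.+1 - 1)).
  by rewrite -invr_expz -exprnP; field.
move=> zn; apply: has_ordN; rewrite -[k + _]add0r; apply: (has_ordM ramP) => //.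
apply: has_ord_unit; rewrite exprnP invr_expz; exact: (local_unitXz ramP).
Qed.

(** If x differed from 1, lifting the exponent would give x^r - 1 = 0 a finite order. *)
Lemma root_of_unity_residue1 (x : algC) (r : nat) : (2 < p)%N -> (0 < r)%N ->
  in_Q theta x -> x ^+ r = 1 -> residue theta F alpha x 1 -> x = 1.
Proof.
move=> p2 r0 Qx xr x1; apply/eqP; rewrite -subr_eq0; apply: contraT => x10.
have [k xk] : exists k, ord (x - 1) k.
  apply: (has_ord_exists ramP) => //; apply: in_QD => //.
  by rewrite -(rmorphN1 (ratr : rat -> algC)); apply: in_Q_ratr.
have := has_ord_expr_sub1 ramP p2 r0 x1 xk; rewrite xr subrr.
by move=> /(has_ord_neq0 ramP); rewrite eqxx.
Qed.

Lemma card_pred_ndvd : ~~ (p %| #|F|.-1)%N.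
Proof.
have F1 := finNzRing_gt1 F; have cF := card_pprimeChar pF.
have pF0 : (p %| #|F|)%N.
  rewrite cF dvdn_exp ?dvdnn //; move: F1; rewrite {1}cF.
  by case: (logn p #|F|).
apply/negP => pF1; have := prime_gt1 p_pr; rewrite ltnNge => /negP; apply.
by apply: dvdn_leq => //; rewrite -(dvdn_addr _ pF1) addn1 prednK // ltnW.
Qed.

End PrimeIdeal.

(** If the order m of w were a proper divisor of r, then w^(r/q) = 1 for any prime q dividing r /
    m. *)
Lemma Cyclotomic_primitive_root (F : fieldType) (r : nat) (w : F) : (1 < r)%N ->
  (forall q, prime q -> (q %| r)%N -> q%:R != 0 :> F) ->
  root (Zto F 'Phi_r) w -> r.-primitive_root w.
Proof.
move=> r1 qF rw; have r0 : (0 < r)%N := ltnW r1.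
have order q : prime q -> (q %| r)%N -> w ^+ r = 1 /\ w ^+ (r %/ q) != 1.
  by move=> q_pr qr; apply: root_Cyclotomic_order => //; [apply: prime_gt1|apply: qF].
have [wr _] := order _ (pdiv_prime r1) (pdiv_dvd r).
have [m wm mr] := prim_order_exists r0 wr.
have [rm|rm] := eqVneq m r; first by rewrite -rm.
have m0 := prim_order_gt0 wm; set t := (r %/ m)%N.
have rE : r = (t * m)%N by rewrite divnK.
have t1 : (1 < t)%N.
  by rewrite ltn_divRL // mul1n ltn_neqAle rm dvdn_leq.
have [_] := order _ (pdiv_prime t1) (dvdn_trans (pdiv_dvd t) (dvdn_div mr)).
have -> : (r %/ pdiv t = t %/ pdiv t * m)%N.
  by rewrite [in LHS]rE -divn_mulAC // pdiv_dvd.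
by rewrite mulnC exprM (prim_expr_order wm) expr1n eqxx.
Qed.

Definition padic_zero_at (K : fieldExtType rat) (U : int -> K) (a : int)
    (P : set (integers K)) (p : nat) : Prop :=
  exists (Q a' : nat) (tau : int),
    [/\ (0 < Q)%N, (a' < Q)%N, ~~ (p %| Q)%N,
        (forall n : int, (n = a'%:Z %[mod Q%:Z])%Z ->
           valuation P (U n) = (padic_valuation p (n - a) + tau%:E)%E)
      & (forall N : nat, exists n : int,
           [/\ (n = a'%:Z %[mod Q%:Z])%Z, n != a
             & (N%:Z%:E <= padic_valuation p (n - a))%E])].

(** At n = a the right-hand side is infinite, so U must vanish there whenever a lies in the
    class. *)
Lemma padic_zero_at_residue_ideal (K : fieldExtType rat) (iota : {rmorphism K -> algC})
    (theta : algC) (f : {poly int}) (p : nat) (F : finFieldType) (alpha : F)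
    (U : int -> K) (a b tau : int) (Q : nat) :
  unramified_point theta f p F alpha -> (forall x, in_Q theta (iota x)) ->
  (0 < Q)%N -> ~~ (p %| Q)%N ->
  ((a = b %[mod Q%:Z])%Z -> U a = 0) ->
  (forall n, (n = b %[mod Q%:Z])%Z -> n != a ->
     has_ord theta p F alpha (iota (U n)) ((logn p `|(n - a)%R|%N)%:Z + tau)) ->
  padic_zero_at K U a (residue_ideal K iota theta F alpha) p.
Proof.
move=> ramP iotaQ Q0 pQ Ua Un.
have p_pr : prime p by case: ramP => /pcharf_prime.
have QZ : Q%:Z != 0 by rewrite gt_eqF // ltz_nat.
have bE : (`|(b %% Q%:Z)%Z|%N%:Z = (b %% Q%:Z)%Z).
  by rewrite gez0_abs // modz_ge0.
exists Q, `|(b %% Q%:Z)%Z|%N, tau; split=> //.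
- by rewrite -ltz_nat bE ltz_pmod // ltz_nat.
- move=> n; rewrite bE modz_mod => nb; have [na|na] := eqVneq n a.
    by rewrite /valuation na Ua -?na // eqxx /padic_valuation subrr eqxx.
  rewrite (valuation_residue_ideal _ _ _ _ _ _ _ ramP iotaQ _ _ (Un n nb na)).
  by rewrite /padic_valuation subr_eq0 (negPf na).
by move=> N; apply: padic_valuation_large.
Qed.

Lemma ltn_sum3 (a b c n : nat) : (a + b + c < n)%N -> [/\ a < n, b < n & c < n]%N.
Proof. by move=> ?; split; lia. Qed.

Lemma ltn_sum4 (a b c d n : nat) :
  (a + b + c + d < n)%N -> [/\ a < n, b < n, c < n & d < n]%N.
Proof. by move=> ?; split; lia. Qed.

Lemma padic_zero_double_root (K : fieldExtType rat) (iota : {rmorphism K -> algC})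
    (U : int -> K) (a : int) (c x : algC) (B : nat) :
  c != 0 -> x != 0 -> (forall n, iota (U n) = c * (n - a)%:~R * x ^ n) ->
  exists p P, [/\ prime p, (B < p)%N, nonzero_prime_ideal P, p%:R \in P &
    padic_zero_at K U a P p].
Proof.
move=> c0 x0 UE; have [theta [itheta iotaQ sQ]] := exists_field_generator K iota [:: c; x].
have [f [f_mon ftheta fdvd]] := exists_monic_minpoly _ itheta.
have [N N0 NP] := exists_unramified _ _ f_mon ftheta fdvd.
have Qc : in_Q theta c by apply: sQ; rewrite mem_head.
have Qx : in_Q theta x by apply: sQ; rewrite !inE eqxx orbT.
have [C C0 CP] := exists_local_unit _ _ f itheta Qc c0.
have [X X0 XP] := exists_local_unit _ _ f itheta Qx x0.
have [p Bp p_pr] := prime_above (B + `|N| + `|C| + `|X|)%N.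
have [B_p /(dvdz_gt _ _ N0) pN /(dvdz_gt _ _ C0) pC /(dvdz_gt _ _ X0) pX] := ltn_sum4 _ _ _ _ _ Bp.
have [F [[|alpha rs] [pF frs rs0 ramP]]] := NP p p_pr pN; first by [].
have {}ramP : unramified_point theta f p F alpha.
  by apply: ramP; rewrite (eqp_root frs) root_prod_XsubC mem_head.
have := CP p F alpha ramP pC; have := XP p F alpha ramP pX => ux uc.
exists p, (residue_ideal K iota theta F alpha); split=> //.
- exact: residue_ideal_nonzero_prime ramP iotaQ.
- apply/mem_set; exact: residue_ideal_p ramP.
(* Since c and x are units at the prime, Q = 1 and tau = 0 work. *)
apply: (padic_zero_at_residue_ideal _ _ _ _ _ _ _ _ _ 0 0 1 ramP iotaQ) => //.
- by rewrite dvdn1 gtn_eqF // prime_gt1.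
- move=> _; apply/eqP; rewrite -(fmorph_eq0 iota) UE subrr mulr0 mul0r //.
move=> n _ na; rewrite UE addr0 -[X in has_ord _ _ _ _ _ X]addr0.
apply: (has_ordM ramP); last by apply: has_ord_unit; apply: (local_unitXz ramP).
rewrite -[X in has_ord _ _ _ _ _ X]add0r.
apply: (has_ordM ramP); first exact: has_ord_unit.
by apply: (has_ord_int _ _ _ _ _ ramP); rewrite subr_eq0.
Qed.

(* With [y = xi * mu ^ m] and [z = mu ^ (r * Q)], [y ^ (r * Q) = z ^ m], and
   [r * Q] is prime to [p]. *)
Lemma has_ord_twisted (theta mu xi : algC) (f : {poly int}) (p : nat)
    (F : finFieldType) (alpha : F) (r Q : nat) (m k t : int) :
  unramified_point theta f p F alpha -> (2 < p)%N ->
  (0 < r * Q)%N -> ~~ (p %| r * Q)%N -> xi ^+ r = 1 -> m != 0 ->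
  residue theta F alpha (xi * mu ^ m) 1 -> residue theta F alpha (mu ^+ (r * Q)) 1 ->
  has_ord theta p F alpha (mu ^+ (r * Q) - 1) t ->
  has_ord theta p F alpha (xi * mu ^ m - 1) k -> k = t + (logn p `|m|%N)%:Z.
Proof.
move=> ramP p2 rQ0 prQ xir m0 y1 z1 zt yk.
have := has_ord_expr_sub1 ramP p2 rQ0 y1 yk.
rewrite lognE (negPf prQ) !andbF addr0 exprMn exprM xir expr1n mul1r.
have -> : (mu ^ m) ^+ (r * Q) = (mu ^+ (r * Q)) ^ m by exact: exprzAC mu m (r * Q)%N.
move=> ykm; apply: (has_ord_uniq ramP ykm).
exact: (has_ord_exprz_sub1 _ _ _ _ _ ramP).
Qed.

Lemma expfz_eq1 (F : fieldType) (x : F) (m : int) : x ^ m = 1 -> x ^+ `|m|%N = 1.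
Proof.
case: m => n //; rewrite NegzE abszN -invr_expz => /eqP.
by rewrite invr_eq1 => /eqP.
Qed.

Lemma padic_zero_simple_roots (K : fieldExtType rat) (iota : {rmorphism K -> algC})
    (U : int -> K) (a : int) (c x mu xi : algC) (r B : nat) :
  c != 0 -> x != 0 -> mu != 0 -> (forall n, (0 < n)%N -> mu ^+ n != 1) ->
  (0 < r)%N -> xi ^+ r = 1 ->
  (forall n, iota (U n) = c * x ^ n * (1 - xi * mu ^ (n - a))) ->
  exists p P, [/\ prime p, (B < p)%N, nonzero_prime_ideal P, p%:R \in P &
    padic_zero_at K U a P p].
Proof.
move=> c0 x0 mu0 mu1 r0 xir UE.
have [theta [itheta iotaQ sQ]] := exists_field_generator K iota [:: c; x; mu; xi].
have [f [f_mon ftheta fdvd]] := exists_monic_minpoly _ itheta.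
have [N N0 NP] := exists_unramified _ _ f_mon ftheta fdvd.
have Qc : in_Q theta c by apply: sQ; rewrite mem_head.
have Qx : in_Q theta x by apply: sQ; rewrite !inE eqxx !orbT.
have Qmu : in_Q theta mu by apply: sQ; rewrite !inE eqxx !orbT.
have Qxi : in_Q theta xi by apply: sQ; rewrite !inE eqxx !orbT.
have [C C0 CP] := exists_local_unit _ _ f itheta Qc c0.
have [X X0 XP] := exists_local_unit _ _ f itheta Qx x0.
have [D [M [D0 DM]]] := Qmu.
have [g [g0 gmu gdvd]] := exists_primitive_minpoly mu.
(* The factor 6 serves [exists_prime_not_Bezout]; the factor r makes the residue of xi a power of
   b^k. *)
have [r6 r6E] : exists r6, r6 = (6 * r)%N by exists (6 * r)%N.
have r6_gt1 : (1 < r6)%N by rewrite r6E; apply: leq_trans (leq_pmulr 6 r0).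
have [||p [k [p_pr Bp k0 nBez]]] := exists_prime_not_Bezout g mu r6
  (B + `|N| + `|C| + `|X| + `|D| + r6)%N g0 gmu mu0 mu1.
- exact: ltnW.
- by rewrite r6E dvdn_mulr.
have [/ltn_sum4[B_p /(dvdz_gt _ _ N0) pN /(dvdz_gt _ _ C0) pC /(dvdz_gt _ _ X0) pX]
  /(dvdz_gt _ _ D0) pD r6p] := ltn_sum3 _ _ _ _ Bp.
have p2 : (2 < p)%N by apply: leq_ltn_trans r6p.
have r_p : (r < p)%N by apply: leq_ltn_trans r6p; rewrite r6E leq_pmull.
have [F [rs [pF frs _ ramP]]] := NP p p_pr pN.
have [alpha falpha] := lying_over theta mu f g ('Phi_r6 \Po 'X^k) M D p F rs
  itheta ftheta gdvd g0 (Cyclotomic_comp_monic _ _ k0) DM pF pD frs nBez.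
have {}ramP := ramP alpha falpha.
have := CP p F alpha ramP pC; have := XP p F alpha ramP pX => ux uc.
set b := (Zto F M).[alpha] / D%:~R.
rewrite /root map_comp_poly map_polyXn horner_comp hornerXn -/(root _ _) => Phib.
have DF : D%:~R != 0 :> F by rewrite -(dvdz_pcharf pF).
have mub : residue theta F alpha mu b.
  by exists D%:P, M; rewrite !map_polyC !hornerC; split=> //=; rewrite mulrC divfK.
have bk_prim : r6.-primitive_root (b ^+ k).
  apply: Cyclotomic_primitive_root => // q q_pr qr.
  rewrite -(dvdn_pcharf pF) dvdn_prime2 //; apply: contraTneq qr => <-.
  by rewrite gtnNdvd // ltnW.
have b0 : b != 0.
  apply: contraTneq isT => b0; have := prim_expr_order bk_prim.
  by rewrite b0 -exprM expr0n gtn_eqF ?muln_gt0 ?k0 1?ltnW // => /eqP; rewrite eq_sym oner_eq0.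
have ixi : integral xi.
  exists ('X^r - 1); first by rewrite monicXnsubC.
  by rewrite rmorphB rmorph1 /= map_polyXn /root hornerD hornerN hornerC hornerXn xir subrr.
have [e xie] := integral_local_integer ramP Qxi ixi.
have er : e ^+ r = 1.
  by have := residueX r xie; rewrite xir => er; rewrite (residue_uniq ramP residue1 er).
have e0 : e != 0.
  by apply: contra_eq_neq er => ->; rewrite expr0n gtn_eqF // eq_sym oner_neq0.
(* The inverse of e is an r-th root of unity, hence a power of the primitive 6r-th root b^k. *)
have [m0 em0] : exists m0 : nat, e * b ^+ m0 = 1.
  have [|i iE] := prim_rootP bk_prim (x := e^-1).
    by rewrite r6E mulnC exprM exprVn er invr1 expr1n.
  by exists (k * i)%N; rewrite exprM -iE mulfV.
set Q := #|F|.-1; have F1 := finNzRing_gt1 F.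
have Q0 : (0 < Q)%N by rewrite /Q -subn1 subn_gt0.
have pQ : ~~ (p %| Q)%N := card_pred_ndvd _ _ _ _ _ ramP.
have bQ : b ^+ Q = 1 by apply: (mulfI b0); rewrite -exprS prednK ?expf_card ?mulr1 // ltnW.
have rQ0 : (0 < r * Q)%N by rewrite muln_gt0 r0.
have prQ : ~~ (p %| r * Q)%N.
  by rewrite Euclid_dvdM // negb_or pQ andbT gtnNdvd.
have zres : residue theta F alpha (mu ^+ (r * Q)) 1.
  by have := residueX (r * Q) mub; rewrite mulnC [b ^+ _]exprM bQ expr1n.
have in_Q_sub1 y : in_Q theta y -> in_Q theta (y - 1).
  move=> Qy; apply: in_QD => //.
  by rewrite -(rmorphN1 (ratr : rat -> algC)); apply: in_Q_ratr.
have in_QX y n : in_Q theta y -> in_Q theta (y ^+ n).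
  move=> Qy; elim: n => [|n IH]; last by rewrite exprS; apply: in_QM.
  by rewrite expr0 -(rmorph1 (ratr : rat -> algC)); apply: in_Q_ratr.
have in_QXz y (n : int) : in_Q theta y -> in_Q theta (y ^ n).
  case: n => n Qy; first exact: in_QX.
  by rewrite NegzE -invr_expz; apply: in_QV => //; apply: in_QX.
have [t zt] : exists t, has_ord theta p F alpha (mu ^+ (r * Q) - 1) t.
  apply: (has_ord_exists ramP); first by apply: in_Q_sub1; apply: in_QX.
  by rewrite subr_eq0 mu1.
have yres n : (n = a + m0%:Z %[mod Q%:Z])%Z -> residue theta F alpha (xi * mu ^ (n - a)) 1.
  move/eqP; rewrite eqz_mod_dvd => /dvdzP[l nE].
  have -> : n - a = m0%:Z + Q%:Z * l by rewrite [_ * l]mulrC -nE; ring.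
  have -> : 1 = e * b ^ (m0%:Z + Q%:Z * l).
    by rewrite expfzDr // -exprz_exp -!exprnP bQ exp1rz mulr1.
  by apply: residueM => //; apply: (residueXz ramP).
exists p, (residue_ideal K iota theta F alpha); split=> //.
- exact: residue_ideal_nonzero_prime ramP iotaQ.
- apply/mem_set; exact: residue_ideal_p ramP.
apply: (padic_zero_at_residue_ideal _ _ _ _ _ _ _ _ _ (a + m0%:Z) t Q ramP iotaQ) => //.
  (* If a itself lies in the class, then xi has residue 1, so xi = 1 and U(a) = 0. *)
  move=> /yres; rewrite subrr expr0z mulr1 => xi1; apply/eqP.
  rewrite -(fmorph_eq0 iota) UE subrr expr0z mulr1.
  by rewrite (root_of_unity_residue1 _ _ _ _ _ ramP _ _ p2 r0 Qxi xir xi1) subrr mulr0.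
move=> n /yres yn na; rewrite UE.
have nma : n - a != 0 by rewrite subr_eq0.
(* Otherwise the r-th power of the equation would make mu a root of unity. *)
have y1 : xi * mu ^ (n - a) - 1 != 0.
  rewrite subr_eq0; apply: contra_neq (mu1 (r * `|(n - a)%R|)%N _) => [y1|]; last first.
    by rewrite muln_gt0 r0 absz_gt0.
  rewrite exprM; apply: expfz_eq1; rewrite exprnP exprzAC -exprnP.
  by rewrite -[LHS]mul1r -xir -exprMn y1 expr1n.
have [l yl] := has_ord_exists ramP (in_Q_sub1 _ (in_QM _ _ _ Qxi (in_QXz _ _ Qmu))) y1.
have lE := has_ord_twisted _ _ _ _ _ _ _ _ _ _ _ _ ramP p2 rQ0 prQ xir nma yn zres zt yl.
have -> : (logn p `|(n - a)%R|%N)%:Z + t = l by rewrite lE addrC.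
rewrite -[1 - xi * _]opprB mulrN; apply: has_ordN.
rewrite -[l]add0r; apply: (has_ordM ramP) => //.
by apply: has_ord_unit; apply: local_unitM => //; apply: (local_unitXz ramP).
Qed.

Theorem theorem6p1 (K : fieldExtType rat) (iota : {rmorphism K -> algC})
    (U : int -> K) (a : int) :
  lrs_of_order 2 U -> non_degenerate iota U -> twisted_zero iota U a ->
  infinite_set [set P : set (integers K) |
    nonzero_prime_ideal P /\
    exists p : nat, [/\ prime p, p%:R \in P &
      exists (Q a' : nat) (tau : int),
        [/\ (0 < Q)%N, (a' < Q)%N, ~~ (p %| Q)%N,
            (forall n : int, (n = a'%:Z %[mod Q%:Z])%Z ->
               valuation P (U n) = (padic_valuation p (n - a) + tau%:E)%E)
          & (forall N : nat, exists n : int,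
               [/\ (n = a'%:Z %[mod Q%:Z])%Z, n != a
                 & (N%:Z%:E <= padic_valuation p (n - a))%E])]]].
Proof.
move=> U2 nondeg tw; apply: infinite_prime_ideals => [P [] //|B].
suff [p [P [p_pr Bp P_prime pP PU]]] : exists p P,
    [/\ prime p, (B < p)%N, nonzero_prime_ideal P, p%:R \in P & padic_zero_at K U a P p].
  by exists p, P; split=> //; split=> //; exists p.
have [[c [x [c0 x0 UE]]]|] := twisted_zero_order2 K iota U U2 a nondeg tw.
  exact: padic_zero_double_root c0 x0 UE.
move=> [c [x [mu [xi [r [[c0 x0 mu0] mu1 r0 xir UE]]]]]].
exact: padic_zero_simple_roots c0 x0 mu0 mu1 r0 xir UE.
Qed.
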